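(* Let $n,k\ge1$ be integers and let $X\subset\mathbb{R}^{(k+1)n}$ be a non-empty Borel set. Then for $\mathcal{L}^k$-almost all $t\in\mathbb{R}^k$, $$\dim\pi_t(X)\ge\frac{\dim X}{k+1}.$$
   Context: $\dim$ denotes Hausdorff dimension and $\mathcal{L}^k$ Lebesgue measure on $\mathbb{R}^k$. Write $x\in\mathbb{R}^{(k+1)n}$ as $x=(x_0,x_1,\dots,x_k)$ with $x_i\in\mathbb{R}^n$. For $t=(t_1,\dots,t_k)\in\mathbb{R}^k$, $\pi_t:\mathbb{R}^{(k+1)n}\to\mathbb{R}^n$ is defined by $\pi_t(x_0,x_1,\dots,x_k)=x_0+t_1x_1+\dots+t_kx_k$. *)

(* Defs.v *)
From HB Require Import structures.
From mathcomp Require Import all_boot all_order all_algebra.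
From mathcomp Require Import all_classical all_reals all_analysis.
Import Order.TTheory GRing.Theory Num.Theory.
Import numFieldNormedType.Exports.

Set Implicit Arguments.
Unset Strict Implicit.
Unset Printing Implicit Defensive.

Local Open Scope classical_set_scope.
Local Open Scope ring_scope.

(* Lebesgue measure on R^k, on the library's product sigma-algebra of
   k.-tuple R: the k-fold product of the one-dimensional Lebesgue measure,
   transported from R * R^k to R^(k+1) by cons. *)

Section cons_measure.
Context (R : realType) (k : nat).
Variable mu : {sigma_finite_measure set (k.-tuple (measurableTypeR R)) -> \bar R}.

Definition tuple_cons (p : measurableTypeR R * k.-tuple (measurableTypeR R)) :
  k.+1.-tuple (measurableTypeR R) := [tuple of p.1 :: p.2].

Lemma measurable_tuple_cons : measurable_fun setT tuple_cons.
Proof. exact: measurable_cons. Qed.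

Definition cons_measure : set (k.+1.-tuple (measurableTypeR R)) -> \bar R :=
  pushforward (lebesgue_measure \x mu)%E tuple_cons.

Let pushforward_cons : {measure set (k.+1.-tuple (measurableTypeR R)) -> \bar R} :=
  measure_function_pushforward__canonical__measure_function_Measure
    (lebesgue_measure \x mu)%E measurable_tuple_cons.

Let cons_measure0 : cons_measure set0 = 0%E.
Proof. exact: (measure0 pushforward_cons). Qed.

Let cons_measure_ge0 A : (0 <= cons_measure A)%E.
Proof. exact: (measure_ge0 pushforward_cons). Qed.

Let cons_measure_sigma_additive : semi_sigma_additive cons_measure.
Proof. exact: (@measure_semi_sigma_additive _ _ _ pushforward_cons). Qed.

HB.instance Definition _ := isMeasure.Build _ _ _ cons_measure
  cons_measure0 cons_measure_ge0 cons_measure_sigma_additive.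

Let cons_measure_sigma_finite : sigma_finite setT cons_measure.
Proof.
have /sigma_finiteP[F [FT ndF Foo]] := sigma_finiteT (@lebesgue_measure R).
have /sigma_finiteP[G [GT ndG Goo]] := sigma_finiteT mu.
pose uncons (t : k.+1.-tuple (measurableTypeR R)) :
  measurableTypeR R * k.-tuple (measurableTypeR R) :=
  (thead t, [tuple of behead t]).
have unconsK : cancel tuple_cons uncons.
  by move=> [x t]; rewrite /uncons /= theadE; congr pair; apply: val_inj.
have muncons : measurable_fun setT uncons.
  by apply/measurable_fun_pairP; split;
    [exact: measurable_tnth | exact: measurable_behead].
exists (fun i => uncons @^-1` (F i `*` G i)).
  apply/esym; rewrite -subTset => t _.
  have [i _ Fi] : (\bigcup_i F i) (uncons t).1 by rewrite -FT.
  have [j _ Gj] : (\bigcup_i G i) (uncons t).2 by rewrite -GT.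
  exists (maxn i j) => //; split.
    by move: Fi; exact/subsetPset/ndF/leq_maxl.
  by move: Gj; exact/subsetPset/ndG/leq_maxr.
move=> i; have [mF Fy] := Foo i; have [mG Gy] := Goo i; split.
  by rewrite -[X in measurable X]setTI; apply: muncons => //; exact: measurableX.
rewrite /cons_measure /pushforward -comp_preimage.
rewrite (_ : uncons \o tuple_cons = id); last by apply/funext => p /=.
by rewrite preimage_id product_measure1E// lte_mul_pinfty// ge0_fin_numE.
Qed.

HB.instance Definition _ :=
  Measure_isSigmaFinite.Build _ _ _ cons_measure cons_measure_sigma_finite.

End cons_measure.

Fixpoint lebesgue_tuple (R : realType) (k : nat) :
    {sigma_finite_measure set (k.-tuple (measurableTypeR R)) -> \bar R} :=
  match k with
  | 0%N => \d_([tuple] : 0.-tuple (measurableTypeR R))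
  | k'.+1 => cons_measure (lebesgue_tuple R k')
  end.

Lemma lebesgue_tuple_box (R : realType) (k : nat)
    (A : 'I_k -> set (measurableTypeR R)) :
  (forall i, measurable (A i)) ->
  lebesgue_tuple R k [set t | forall i, A i (tnth t i)] =
  (\prod_(i < k) lebesgue_measure (A i))%E.
Proof.
elim: k A => [|k IHk] A mA.
  rewrite big_ord0 /= /dirac indicE mem_set//=.
  by case.
rewrite big_ord_recl -IHk//= /cons_measure /pushforward.
rewrite -product_measure1E//; last first.
  rewrite (_ : mkset _ = \bigcap_(i in [set: 'I_k])
      ((@tnth _ (measurableTypeR R))^~ i @^-1` A (lift ord0 i))).
    apply: fin_bigcap_measurable => // i _.
    by rewrite -[X in measurable X]setTI; exact: measurable_tnth.
  by apply/seteqP; split=> t /= At i; [move=> _; exact: At | exact: At].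
congr ((_ \x _)%E _); apply/seteqP; split=> -[x t] /=.
  move=> At; split; first exact: (At ord0).
  by move=> i; have := At (lift ord0 i); rewrite tnthS.
move=> [Ax At] i; case: (unliftP ord0 i) => [j ->|->]; last exact: Ax.
by rewrite tnthS; exact: At.
Qed.

Section hausdorff.
Context (R : realType) (m : nat).
Implicit Types (s d : R) (A : set 'rV[R]_m).

(* The library's norm on 'rV[R]_m is the sup norm, hence this definition. *)
Definition edist (x y : 'rV[R]_m) : R :=
  Num.sqrt (\sum_(i < m) (x 0 i - y 0 i) ^+ 2).

(* Meant for nonempty A: the value at set0 is -oo. *)
Definition ediam A : \bar R :=
  ereal_sup [set (edist x y)%:E | x in A & y in A].

(* diam(A)^s, with diam(set0)^s = 0 for all s, and 0^0 = 1 for singletons. *)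
Definition ediam_pow s A : \bar R :=
  if A == set0 then 0%E else (ediam A `^ s)%E.

Definition hausdorff_content s d A : \bar R :=
  ereal_inf [set (\sum_(i <oo) ediam_pow s (U i))%E |
    U in [set U : (set 'rV[R]_m)^nat |
      A `<=` \bigcup_i U i /\ forall i, (ediam (U i) <= d%:E)%E]].

Definition hausdorff_measure s A : \bar R :=
  ereal_sup [set hausdorff_content s d A | d in [set d : R | 0 < d]].

Definition hausdorff_dim A : \bar R :=
  ereal_inf [set s%:E | s in [set s : R | 0 <= s /\ hausdorff_measure s A = 0%E]].

End hausdorff.

(* A point x of R^((k+1)n) is split into consecutive blocks of length n:
   row i (vec_mx x) is x_i. *)
Definition block_proj (R : realType) (n k : nat)
    (t : k.-tuple R) (x : 'rV[R]_(k.+1 * n)) : 'rV[R]_n :=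
  row ord0 (vec_mx x) + \sum_(i < k) tnth t i *: row (lift ord0 i) (vec_mx x).

(* Main.v *)
(* Write P = 2^q and let alpha > (k+1)q be smaller than dim X. The dyadic net
   content of dimension alpha of X is positive and continuous from below along
   increasing sequences of arbitrary sets; as X is Borel, hence analytic,
   Choquet's argument gives decreasing subsets A_N of X of content > a such that
   every countable open cover of X has a finite subfamily covering some A_N.
   Suppose pi_t(X) has q-dimensional Hausdorff measure zero for the t of a set
   of positive outer measure. For a smaller set of parameters, still of outer
   measure > eps, the balls needed for one A_N have radii between 2^-N and
   2^-j0. Put a discrete Frostman measure on A_N and discretize the parameters
   by a fine grid. By pigeonhole there is one scale 2^-j such that, for a
   proportion of pairs (x,t) of order at least theta^j, where theta < 1 is chosen
   close to 1, pi_t(x) is in one of the at most 2^(jq) balls of radius about 2^-j. Averaging produces a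
   parameter t and, for each i, a parameter differing from t essentially in its
   i-th coordinate only, by a not too small amount, such that many x are good
   for all k+1 parameters at once. Since these k+1 projections determine x up
   to a factor of order theta^-j, such x lie in about 2^(j(k+1)q) sets of diameter about
   2^-j, of total mass at most 2^(j((k+1)q-alpha)) up to powers of
   theta^-j: a contradiction when j0 is large. *)

Require Import Defs.
From mathcomp Require Import all_boot all_order all_algebra.
From mathcomp Require Import all_classical all_reals all_analysis.
From mathcomp Require Import zify ring lra.
Import Order.TTheory GRing.Theory Num.Theory.
Import numFieldNormedType.Exports.
Set Implicit Arguments.
Unset Strict Implicit.
Unset Printing Implicit Defensive.
Local Open Scope classical_set_scope.
Local Open Scope ring_scope.

(** * Net contents *)

Section esum_extra.
Context (R : realType) (T : choiceType) (a : T -> R).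
Hypothesis a0 : forall q, (0 <= a q)%R.
Local Notation cost U := (\esum_(q in U) (a q)%:E)%E.

Lemma esum_subset (U V : set T) : U `<=` V -> (cost U <= cost V)%E.
Proof.
move=> UV; rewrite esum_mkcond [leRHS]esum_mkcond; apply: le_esum => q _.
case: ifPn => [/set_mem/UV/mem_set ->//|_]; case: ifPn => // _.
by rewrite lee_fin.
Qed.

Lemma esum_setUI (U V : set T) :
  (cost (U `|` V) + cost (U `&` V) = cost U + cost V)%E.
Proof.
rewrite !(esum_mkcond _ (fun q => (a q)%:E)) -!esumD; first last.
- by move=> i _; case: ifP; rewrite // lee_fin.
- by move=> i _; case: ifP; rewrite // lee_fin.
- by move=> i _; case: ifP; rewrite // lee_fin.
- by move=> i _; case: ifP; rewrite // lee_fin.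
apply: eq_esum => q _; rewrite in_setU in_setI.
by case: (q \in U); case: (q \in V) => //=; rewrite ?adde0 ?add0e.
Qed.

Lemma esum_setU_le (U V : set T) : (cost (U `|` V) <= cost U + cost V)%E.
Proof.
by rewrite -esum_setUI leeDl// esum_ge0// => q _; rewrite lee_fin.
Qed.

Lemma esum_setID (U V : set T) : (cost U = cost (U `&` V) + cost (U `\` V))%E.
Proof. by rewrite (esumID V)// => q _; rewrite lee_fin. Qed.

End esum_extra.

Section net_content.
Context (R : realType) (P : Type) (Z : choiceType).
Variables (c : nat -> P -> Z) (b : nat -> R).
Hypothesis nested : forall i j x y, (i <= j)%N -> c j x = c j y -> c i x = c i y.
Hypothesis b0 : forall j, 0 <= b j.
Implicit Types (E : set P) (U V : set (nat * Z)).

(* A pair [(j, z)] stands for the cell [{x | c j x = z}] of level [j], of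
   weight [b j]. *)
Definition net_cost U : \bar R := \esum_(q in U) (b q.1)%:E.

Definition net_cover U E := forall x, E x -> exists j, U (j, c j x).

Definition net_content E : \bar R :=
  ereal_inf [set net_cost U | U in [set U | net_cover U E]].

Lemma net_cost_ge0 U : (0 <= net_cost U)%E.
Proof. by apply: esum_ge0 => q _; rewrite lee_fin. Qed.

Lemma net_content_ge0 E : (0 <= net_content E)%E.
Proof. by apply: le_ereal_inf_tmp => _ [U _ <-]; exact: net_cost_ge0. Qed.

Lemma net_content_le U E : net_cover U E -> (net_content E <= net_cost U)%E.
Proof. by move=> UE; apply: ereal_inf_lbound; exists U. Qed.

(** By nestedness, these are the cells of [U] that lie in no strictly coarser cell of [U]. *)
Definition net_max U : set (nat * Z) :=
  [set q | U q /\ forall i x, (i < q.1)%N -> c q.1 x = q.2 -> ~ U (i, c i x)].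

Lemma net_max_sub U : net_max U `<=` U. Proof. by move=> q []. Qed.

Lemma net_max_cover U E : net_cover U E -> net_cover (net_max U) E.
Proof.
move=> UE x /UE[j0 Uj0].
have ex : exists j, `[< U (j, c j x) >] by exists j0; apply/asboolP.
exists (ex_minn ex); case: ex_minnP => j /asboolP Uj jmin; split=> // i y ij.
move=> /= /(nested (ltnW ij)) -> /asboolP/jmin.
by rewrite leqNgt ij.
Qed.

(* Strong subadditivity: what is dropped when passing from [M `|` U] to its
   maximal cells, together with [M `&` U], still covers [E]. *)
Lemma net_cost_merge M U E : net_cover M E -> net_cover U E ->
  (net_cost (net_max (M `|` U)) + net_content E <= net_cost M + net_cost U)%E.
Proof.
move=> ME UE; set X := net_max _; pose Y := (M `|` U) `\` X.
(* If the two covers catch [x] at different levels, the finer cell is not maximal and so lies in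
   [Y]; at equal levels they share a cell. *)
have YE : net_cover (Y `|` (M `&` U)) E.
  move=> x Ex; have [j Mj] := ME _ Ex; have [i Ui] := UE _ Ex.
  have [ij|ji|e] := ltngtP i j; last by exists j; right; split=> //; rewrite -e.
    exists j; left; split; first by left.
    by move=> [_ /(_ i x ij erefl)]; apply; right.
  exists i; left; split; first by right.
  by move=> [_ /(_ j x ji erefl)]; apply; left.
rewrite -[leRHS]esum_setUI//.
rewrite [in leRHS](esum_setID _ (M `|` U) X)//.
rewrite (setIidr (@net_max_sub _)) -addeA leeD2l//.
exact: le_trans (net_content_le YE) (esum_setU_le _ _ _).
Qed.

Section increasing.
Variables (E : nat -> set P) (eps : nat -> R) (U : nat -> set (nat * Z)) (a : R).
Hypothesis ndE : forall n, E n `<=` E n.+1.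
Hypothesis Efin : forall n, net_content (E n) \is a fin_num.
Hypothesis UE : forall n, net_cover (U n) (E n).
Hypothesis UEe : forall n, (net_cost (U n) <= net_content (E n) + (eps n)%:E)%E.

(** The covers are merged one at a time, so that the errors [eps i] add up while the contents of the
    [E i] telescope. *)
Let M := fix M n := if n is n'.+1 then net_max (M n' `|` U n) else U 0%N.

Let ME n : net_cover (M n) (E n).
Proof.
case: n => [|n]; first exact: UE.
by apply: net_max_cover => x /UE[j Uj]; exists j; right.
Qed.

(** [U n.+1] also covers [E n], so merging costs at most [M n] plus [U n.+1] minus the content of
    [E n]; finiteness of the contents allows the cancellation. *)
Let M_cost n :
  (net_cost (M n) <= net_content (E n) + (\sum_(i < n.+1) eps i)%:E)%E.
Proof.
elim: n => [|n IH]; first by rewrite big_ord1; exact: UEe.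
have UEn : net_cover (U n.+1) (E n) by move=> x /ndE/UE.
have := net_cost_merge (@ME n) UEn; rewrite -/(M n.+1).
move: IH (UEe n.+1); rewrite [\sum_(i < n.+2) _]big_ord_recr/=.
rewrite -(fineK (Efin n)) -(fineK (Efin n.+1)).
set e := net_cost (net_max _); move: (net_cost (M n)) (net_cost (U n.+1)) e => u v e.
move: (\sum_(i < n.+1) eps i) (fine _) (fine _) => s f f'.
case: u => [u| |]; case: v => [v| |]; case: e => [e| |] //=;
  rewrite ?leNye// -?EFinD ?lee_fin//; lra.
Qed.

Let M_sub n : M n `<=` \bigcup_i U i.
Proof.
elim: n => [|n IH] q; first by exists 0%N.
by move=> [[/IH//|Uq] _]; exists n.+1.
Qed.

(** A cell that is maximal among all the covers is never dropped by a merge once it has appeared. *)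
Let M_large q : net_max (\bigcup_i U i) q ->
  exists n0, forall n, (n0 <= n)%N -> M n q.
Proof.
move=> [[n0 _ Uq] qmax]; exists n0.
have step n : (M n `|` U n.+1) q -> M n.+1 q.
  move=> Mq; split=> // i x iq xq [/M_sub|Ui]; first exact: qmax.
  by apply: (qmax i x iq xq); exists n.+1.
elim=> [|n IH]; first by rewrite leqn0 => /eqP e0; rewrite e0 in Uq.
rewrite leq_eqVlt => /predU1P[e|]; last by rewrite ltnS => /IH ?; apply: step; left.
by apply: step; right; rewrite -e.
Qed.

(* The maximal cells of all the covers [U n] together: any finitely many of them
   belong to the merged cover [M n] for [n] large. *)
Lemma net_content_bigcup_aux (d : R) :
  (forall n, (net_content (E n) <= a%:E)%E) ->
  (forall n, \sum_(i < n) eps i <= d) ->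
  (net_content (\bigcup_n E n) <= a%:E + d%:E)%E.
Proof.
move=> Ea epsd; pose W := net_max (\bigcup_i U i).
have WE : net_cover W (\bigcup_n E n).
  apply: net_max_cover => x [n _ /UE[j Uj]].
  by exists j; exists n.
apply: (le_trans (net_content_le WE)).
apply: ge_ereal_sup => _ [F [finF FW] <-].
have [n Fn] : exists n, F `<=` M n.
  have /choice[g gP] q : exists n0, W q -> forall n, (n0 <= n)%N -> M n q.
    have [/M_large[n0 ?]|nW] := pselect (W q); first by exists n0.
    by exists 0%N => /nW.
  have /finite_seqP[s Fs] := finF.
  exists (\max_(q <- s) g q) => q Fq; apply: gP; first exact: FW.
  by rewrite (big_rem q)/= ?leq_maxl//; rewrite Fs in Fq.
apply: (@le_trans _ _ (net_cost (M n))); first by apply: esum_ge; exists F.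
by apply: (le_trans (M_cost n)); rewrite leeD// lee_fin.
Qed.

End increasing.

(** Continuity from below for arbitrary increasing sets, in the form required of a capacity. If all
    contents were at most [a], near-optimal covers with errors of total below [e] could be merged
    into a cover of the union. *)
Lemma net_content_bigcup (E : nat -> set P) (a : R) :
  (forall n, E n `<=` E n.+1) -> (a%:E < net_content (\bigcup_n E n))%E ->
  exists n, (a%:E < net_content (E n))%E.
Proof.
move=> ndE aE; apply: contrapT => /forallNP Ea.
have {}Ea n : (net_content (E n) <= a%:E)%E by rewrite leNgt; apply/negP/Ea.
have Efin n : net_content (E n) \is a fin_num.
  by rewrite ge0_fin_numE ?net_content_ge0// (le_lt_trans (Ea n)) ?ltry.
have : (net_content (\bigcup_n E n) <= a%:E)%E.
  apply/lee_addgt0Pr => e e0.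
  pose eps n : R := e / (2 ^ n.+1)%:R.
  have eps0 n : 0 < eps n by rewrite divr_gt0// ltr0n expn_gt0.
  have /choice[U UP] n : exists U, net_cover U (E n) /\
      (net_cost U <= net_content (E n) + (eps n)%:E)%E.
    have [_ [U UE <-] Ult] := lb_ereal_inf_adherent (eps0 n) (Efin n).
    by exists U; split=> //; exact: ltW.
  apply: (@net_content_bigcup_aux E eps U) => //.
  - by move=> n; exact: (UP n).1.
  - by move=> n; exact: (UP n).2.
  - move=> n; suff -> : \sum_(i < n) eps i = e - e / (2 ^ n)%:R.
      by rewrite gerBl divr_ge0// ltW.
    elim: n => [|n IH]; first by rewrite big_ord0 expn0 divr1 subrr.
    rewrite big_ord_recr/= IH /eps expnS natrM invfM.
    by set y := ((2 ^ n)%:R)^-1; lra.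
by rewrite leNgt aE.
Qed.

End net_content.

(** * Analytic sets and capacitability *)

Local Notation baire := (prod_topology (fun _ : nat => nat)).

Section analytic.
Context (T : topologicalType).
Implicit Types (A : set T) (C : set (T * baire)).

(** Suslin sets, encoded as projections of closed subsets of the product with Baire space; the
    second coordinate is called a witness below. *)
Definition analytic A := exists2 C : set (T * baire), closed C &
  A = [set p.1 | p in (C : set (T * baire))].

Lemma continuous_prod_topology (S : topologicalType) (f : S -> baire) :
  (forall i, continuous (fun s => f s i : nat)) -> continuous f.
Proof.
move=> cf s; apply/cvg_sup => i U /=.
rewrite [X in X _ -> _]/nbhs /= => -[_ [[B oB <-] /= Bs] BU].
apply: filterS BU _; apply: (cf i s B).
exact: open_nbhs_nbhs.
Qed.

Lemma continuous_baire_coord i : continuous (fun p : T * baire => p.2 i : nat).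
Proof.
move=> p; apply: (@continuous_comp _ _ _ snd (fun f : baire => f i)).
  exact: cvg_snd.
exact: (@proj_continuous nat (fun=> nat) i).
Qed.

Lemma closed_reindex (g : nat -> nat) C : closed C ->
  closed [set p : T * baire | C (p.1, (fun n => p.2 (g n)) : baire)].
Proof.
move=> cC.
pose f (p : T * baire) : T * baire := (p.1, (fun n => p.2 (g n)) : baire).
have cf : continuous f.
  move=> p; pose h (q : T * baire) : baire := fun n => q.2 (g n).
  apply: (@cvg_pair _ _ _ (nbhs p) (nbhs p.1) (nbhs (h p)) _ _ _ fst h).
    exact: cvg_fst.
  by apply: (@continuous_prod_topology (T * baire)%type h) => i;
    exact: continuous_baire_coord.
by have /continuous_closedP := cf; apply.
Qed.

Lemma closed_analytic A : closed A -> analytic A.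
Proof.
move=> cA; exists [set p : T * baire | A p.1].
  have /continuous_closedP : continuous (@fst T baire) by move=> p; exact: cvg_fst.
  exact.
apply/seteqP; split=> [x Ax|x [p Ap <-]//].
by exists (x, (fun=> 0%N) : baire).
Qed.

(** The first coordinate of the new witness names the index [i], and its shift is a witness for
    [A i]. *)
Lemma analytic_bigcup (A : nat -> set T) :
  (forall i, analytic (A i)) -> analytic (\bigcup_i A i).
Proof.
move=> /(_ _)/cid2-/all_sig[C] /all_and2[cC AC].
exists (\bigcap_i ([set p : T * baire | p.2 0%N != i] `|`
    [set p : T * baire | C i (p.1, (fun n => p.2 n.+1) : baire)])).
  apply: closed_bigI => i _; apply: closedU; last exact: (@closed_reindex succn _ (cC i)).
  have /continuous_closedP := @continuous_baire_coord 0%N.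
  by move/(_ [set j | j != i]); apply; exact: discrete_closed.
apply/seteqP; split=> [x [i _]|x [[y s] /= Cs <-]].
  rewrite AC => -[[y s] /= Cs <-].
  exists (y, (fun n => if n is m.+1 then s m else i) : baire) => //= j _.
  by have [<-|ij] := eqVneq i j; [right|left].
exists (s 0%N) => //; rewrite AC; exists (y, (fun n => s n.+1) : baire) => //.
by have /= := Cs (s 0%N) I; rewrite eqxx => -[].
Qed.

(** One sequence encodes witnesses for all [A i] at once, through the numbering of pairs by
    [pickle]. *)
Lemma analytic_bigcap (A : nat -> set T) :
  (forall i, analytic (A i)) -> analytic (\bigcap_i A i).
Proof.
move=> /(_ _)/cid2-/all_sig[C] /all_and2[cC AC].
exists (\bigcap_i [set p : T * baire |
    C i (p.1, (fun n => p.2 (pickle (i, n))) : baire)]).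
  by apply: closed_bigI => i _; exact: (@closed_reindex (fun n => pickle (i, n)) _ (cC i)).
apply/seteqP; split=> [x Ax|x [[y s] /= Cs <-] i _]; last first.
  rewrite AC; exists (y, (fun n => s (pickle (i, n))) : baire) => //.
  exact: Cs.
have /choice[s sC] i : exists s : baire, C i (x, s).
  by have := Ax i I; rewrite AC => -[[y s] /= Cs <-]; exists s.
exists (x, (fun n => let p := odflt (0, 0)%N (unpickle n) in s p.1 p.2) : baire) => //.
move=> i _ /=; have -> // : (fun n => let p := odflt (0, 0)%N
  (unpickle (pickle (i, n))) in s p.1 p.2) = s i.
by apply/funext => n; rewrite pickleK.
Qed.

Lemma analyticI A B : analytic A -> analytic B -> analytic (A `&` B).
Proof.
move=> aA aB; rewrite -bigcap2E; apply: analytic_bigcap => -[|[|n]] //=.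
exact/closed_analytic/closedT.
Qed.

End analytic.

(** An open set is the union over [n] of the closed sets of points at distance at least [n.+1%:R^-1]
    from every point of its complement. *)
Lemma open_Fsigma_analytic (R : realType) (V : normedModType R) (U : set V) :
  open U -> analytic U.
Proof.
move=> oU.
have -> : U = \bigcup_n \bigcap_(y in ~` U) [set x | n.+1%:R^-1 <= `|x - y|].
  apply/seteqP; split=> x.
    move=> Ux; have /nbhs_ballP[e /= e0 xeU] := open_nbhs_nbhs (conj oU Ux).
    exists (Num.truncn e^-1) => // y /= Uy; rewrite leNgt; apply/negP => xy.
    apply/Uy/xeU; rewrite -ball_normE /=; apply: (lt_le_trans xy).
    rewrite invf_ple ?posrE//.
    exact/ltW/truncnS_gt.
  move=> [n _ xn]; apply: contrapT => /xn /=.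
  by rewrite subrr normr0 leNgt invr_gt0 ltr0n.
apply: analytic_bigcup => n; apply: closed_analytic; apply: closed_bigI => y _.
have /continuous_closedP : continuous (fun x : V => `|x - y|).
  move=> x; apply: cvg_norm.
  by apply: cvgB; [exact: cvg_id|exact: cvg_cst].
by move/(_ [set r | n.+1%:R^-1 <= r]); apply; exact: closed_ge.
Qed.

(** The analytic sets with analytic complement form a sigma-algebra containing the open sets. *)
Lemma borel_analytic (R : realType) (V : normedModType R) (X : set V) :
  <<s open >> X -> analytic X.
Proof.
suff : <<s @open V >> `<=` [set A | analytic A /\ analytic (~` A)].
  by move=> + BX => /(_ _ BX)[].
apply: smallest_sub; last first.
  move=> U oU; split; first exact: open_Fsigma_analytic.
  by apply/closed_analytic; rewrite closedC.
split=> [|A [aA aCA]|A aA].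
- split; first exact/closed_analytic/closed0.
  by rewrite setC0; exact/closed_analytic/closedT.
- by rewrite setTD; split=> //; rewrite setCK.
- split; first by apply: analytic_bigcup => i; exact: (aA i).1.
  by rewrite setC_bigcup; apply: analytic_bigcap => i; exact: (aA i).2.
Qed.

Section capacitability.
Context (R : realType) (T : topologicalType).
Variables (cap : set T -> \bar R) (X K : set T) (a : R).
Hypothesis cap_bigcup : forall E : nat -> set T,
  (forall n, E n `<=` E n.+1) -> (a%:E < cap (\bigcup_n E n))%E ->
  exists n, (a%:E < cap (E n))%E.

(* [A n] consists of the points having a witness in Baire space whose first [n]
   coordinates are at most the bounds chosen inductively. *)
Lemma analytic_capacitable : analytic X -> compact K -> X `<=` K ->
  (a%:E < cap X)%E ->
  exists A : nat -> set T, [/\ forall n, A n `<=` X,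
    forall n, A n.+1 `<=` A n, forall n, (a%:E < cap (A n))%E &
    forall V : nat -> set T, (forall i, open (V i)) -> X `<=` \bigcup_i V i ->
      exists N, A N `<=` \bigcup_(i in [set i | (i < N)%N]) V i].
Proof.
move=> [C cC XC] cK XK aX.
pose S (l : seq nat) := [set x | exists s : baire, C (x, s) /\
  forall i, (i < size l)%N -> (s i <= nth 0 l i)%N].
have SX l : S l `<=` X by move=> x [s [Cs _]]; rewrite XC; exists (x, s).
have Srcons l b : S (rcons l b) `<=` S l.
  move=> x [s [Cs sl]]; exists s; split=> // i il.
  by have := sl i; rewrite size_rcons nth_rcons il; apply; exact: ltnW.
(* [S l] is the increasing union of the sets [S (rcons l b)], so continuity from below yields a
   bound [b] for the next coordinate that keeps the capacity above [a]. *)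
have /choice[next nextP] l : exists b,
    (a%:E < cap (S l))%E -> (a%:E < cap (S (rcons l b)))%E.
  have [al|] := pselect (a%:E < cap (S l))%E; last by exists 0%N.
  have SE : S l = \bigcup_b S (rcons l b).
    apply/seteqP; split=> x; last by move=> [b _]; exact: Srcons.
    move=> [s [Cs sl]]; exists (s (size l)) => //; exists s; split=> // i.
    rewrite size_rcons ltnS leq_eqVlt nth_rcons => /predU1P[->|il].
      by rewrite ltnn eqxx.
    by rewrite il; exact: sl.
  rewrite SE in al; have [|b ab] := cap_bigcup _ al; last by exists b.
  move=> b x [s [Cs sl]]; exists s; split=> // i.
  rewrite size_rcons => il; have := sl i; rewrite size_rcons => /(_ il).
  rewrite !nth_rcons; case: ltnP => // _; case: eqP => // _ /leq_trans; apply.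
  exact: leqnSn.
pose l := fix l n := if n is n'.+1 then rcons (l n') (next (l n')) else [::].
have sl n : size (l n) = n by elim: n => //= n; rewrite size_rcons => ->.
have nl n i : (i < n)%N -> nth 0%N (l n) i = next (l i).
  elim: n => // n IH; rewrite ltnS leq_eqVlt => /predU1P[->|im] /=.
    by rewrite nth_rcons sl ltnn eqxx.
  by rewrite nth_rcons sl im IH.
exists (fun n => S (l n)); split=> [n|n|n|V oV XV].
- exact: SX.
- exact: Srcons.
- elim: n => [|n IH]; last exact: nextP.
  suff -> : S (l 0%N) = X by [].
  apply/seteqP; split; first exact: SX.
  by move=> x; rewrite XC => -[[y s] Cs <-]; exists s.
apply: contrapT => /forallNP nV.
(* If no [A N] is covered by the first [N] open sets, choose an uncovered point of each together
   with its witness. *)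
have {nV} /choice[u uP] N : exists p : T * baire, [/\ C p,
    forall i, (i < N)%N -> (p.2 i <= next (l i))%N &
    forall i, (i < N)%N -> ~ V i p.1].
  have /existsNP[x /not_implyP[[s [Cs sN]] nVx]] := nV N.
  exists (x, s); split=> //= i iN.
    by have := sN i; rewrite sl nl//; exact.
  by move=> Vx; apply: nVx; exists i.
(* A bound on coordinate [i] for all witnesses at once: [next] handles the indices [n > i], and a
   finite maximum the others. The witnesses then stay in a compact product. *)
pose B i := maxn (next (l i)) (\max_(n < i.+1) (u n).2 i).
have uB n i : ((u n).2 i <= B i)%N.
  rewrite leq_max; have [ni|ni] := ltnP i n.
    by apply/orP; left; have [_ + _] := uP n; exact.
  apply/orP; right; rewrite -ltnS in ni.
  exact: (leq_bigmax_cond (Ordinal ni)).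
have cB : compact [set s : baire | forall i, [set j | (j <= B i)%N] (s i)].
  apply: (@tychonoff nat (fun=> nat) (fun i => [set j | (j <= B i)%N])) => i.
  apply: finite_compact.
  by apply: (sub_finite_set _ (finite_II (B i).+1)) => j /=; rewrite ltnS.
have uK n : (K `*` [set s : baire | forall i, (s i <= B i)%N]) (u n).
  split; last by move=> i /=; exact: uB.
  by apply/XK; rewrite XC; exists (u n) => //; have [] := uP n.
have [[x s] [_ clu]] : (K `*` [set s : baire | forall i, (s i <= B i)%N])
    `&` cluster (u @ \oo) !=set0.
  have FK : (u @ \oo) (K `*` [set s : baire | forall i, (s i <= B i)%N]).
    by exists 0%N => // n _; exact: uK.
  by have := compact_setX cK cB; move=> /(_ (u @ \oo) _ FK).
(* A cluster point stays in the closed set [C], so [x] is in [X] and in some [V i]; but [u n] avoids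
   [V i] for every [n > i]. *)
have Cxs : C (x, s).
  have uC : (u @ \oo) C by exists 0%N => // n _ /=; have [] := uP n.
  by apply: cC => W; exact: clu.
have [i _ Vix] : (\bigcup_i V i) x.
  by apply: XV; rewrite XC; exists (x, s).
have FV : (u @ \oo) [set p | ~ V i p.1].
  by exists i.+1 => // n /= ni; have [_ _] := uP n; exact.
have NV : nbhs (x, s) [set p | V i p.1].
  exists (V i, setT); last by move=> p [].
  by split; [exact: (open_nbhs_nbhs (conj (oV i) Vix))|exact: filterT].
by have [[y t] []] := clu _ _ FV NV.
Qed.

End capacitability.

(** * Discrete Frostman measures *)

Section finite_frostman.
Context (R : realFieldType) (I : finType) (Z : eqType).
Variables (c : nat -> I -> Z) (b : nat -> R).
Hypothesis nested : forall i j x y, (i <= j)%N -> c j x = c j y -> c i x = c i y.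
Hypothesis b0 : forall j, 0 <= b j.

Definition cell_mass (w : I -> R) j x := \sum_(y | c j y == c j x) w y.

Lemma eq_cell_mass w i j x y : (i <= j)%N -> c j x = c j y ->
  cell_mass w i x = cell_mass w i y.
Proof. by move=> ij /(nested ij) xy; rewrite /cell_mass xy. Qed.

(* Each cell of level [n] carrying too much mass is scaled down to saturation;
   the cells of finer levels only lose mass. *)
Let frostman_step (w : I -> R) (J n : nat) : (n < J)%N -> (forall x, 0 <= w x) ->
  (forall j x, (n < j <= J)%N -> cell_mass w j x <= b j) ->
  (forall x, exists2 j, (n < j <= J)%N & cell_mass w j x = b j) ->
  exists w' : I -> R, [/\ forall x, 0 <= w' x,
    forall j x, (n <= j <= J)%N -> cell_mass w' j x <= b j &
    forall x, exists2 j, (n <= j <= J)%N & cell_mass w' j x = b j].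
Proof.
move=> nJ w0 wb wsat; pose m := cell_mass w n.
pose r x := if m x <= b n then 1 else b n / m x.
have m0 j x : 0 <= cell_mass w j x by apply: sumr_ge0.
have r0 x : 0 <= r x by rewrite /r; case: ifP => // _; rewrite divr_ge0 ?m0.
have r1 x : r x <= 1.
  rewrite /r; case: (leP (m x)) => // bm.
  by rewrite ler_pdivrMr ?mul1r ?(ltW bm)// (le_lt_trans (b0 n)).
have rE j x : (n <= j)%N ->
    cell_mass (fun y => r y * w y) j x = r x * cell_mass w j x.
  move=> nj; rewrite /cell_mass mulr_sumr; apply: eq_bigr => y /eqP yx.
  by rewrite /r /m (eq_cell_mass _ nj yx).
exists (fun x => r x * w x); split=> [x|j x /andP[nj jJ]|x].
- exact: mulr_ge0.
- rewrite rE//; move: nj; rewrite leq_eqVlt => /predU1P[<-|nj]; last first.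
    by rewrite (le_trans (ler_piMl _ (r1 _)))// wb// nj.
  rewrite -/(m x) /r; case: (leP (m x)) => [|bm]; first by rewrite mul1r.
  by rewrite divfK// gt_eqF// (le_lt_trans (b0 n)).
- have [mb|bm] := leP (m x) (b n).
    have [j /andP[nj jJ] jsat] := wsat x; exists j; first by rewrite (ltnW nj).
    by rewrite rE ?(ltnW nj)// /r mb mul1r.
  exists n; first by rewrite leqnn ltnW.
  by rewrite rE// -/(m x) /r leNgt bm/= divfK// gt_eqF// (le_lt_trans (b0 n)).
Qed.

(** Start at level [J] with each cell saturated by equal weights, then correct the levels from [J]
    down to [0]; every point keeps a saturated cell. *)
Lemma finite_frostman (J : nat) : exists w : I -> R, [/\ forall x, 0 <= w x,
  forall j x, (j <= J)%N -> cell_mass w j x <= b j &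
  forall x, exists2 j, (j <= J)%N & cell_mass w j x = b j].
Proof.
suff H n : (n <= J)%N -> exists w : I -> R, [/\ forall x, 0 <= w x,
    forall j x, (J - n <= j <= J)%N -> cell_mass w j x <= b j &
    forall x, exists2 j, (J - n <= j <= J)%N & cell_mass w j x = b j].
  have [w [w0 wb wsat]] := H J (leqnn J); exists w; split=> // [j x jJ|x].
    by apply: wb; rewrite subnn jJ.
  by have [j /andP[_ jJ] jsat] := wsat x; exists j.
elim: n => [_|n IH nJ].
  pose w x := b J / #|[pred y | c J y == c J x]|%:R.
  have wE x : cell_mass w J x = b J.
    rewrite /cell_mass (eq_bigr (fun=> w x)); last first.
      by move=> y /eqP yx; rewrite /w yx.
    rewrite sumr_const -mulr_natr divfK// pnatr_eq0 -lt0n.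
    by apply/card_gt0P; exists x; rewrite inE.
  exists w; split=> [x|j x|x].
  - by rewrite divr_ge0.
  - by rewrite subn0 -eqn_leq => /eqP <-; rewrite wE.
  - by exists J; rewrite ?subn0 ?leqnn.
have [w [w0 wb wsat]] := IH (ltnW nJ).
have e : (J - n)%N = (J - n.+1).+1 by rewrite -subSn// subSS.
rewrite e in wb wsat; apply: (frostman_step _ w0 wb wsat).
by rewrite -e leq_subr.
Qed.

End finite_frostman.

Lemma finite_representatives (P : Type) (Z : eqType) (f : P -> Z) (A : set P) :
  finite_set (f @` A) -> exists p (x : 'I_p -> P), (forall i, A (x i)) /\
    forall q, A q -> exists i, f q = f (x i).
Proof.
move=> /finite_seqP[s fs].
have /choice[x xP] i : exists y, A y /\ f y = tnth (in_tuple s) i.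
  have : [set` s] (tnth (in_tuple s) i) by rewrite /= mem_tnth.
  by rewrite -fs => -[q Aq fq]; exists q.
exists (size s), x; split=> [i|q Aq]; first exact: (xP i).1.
have : [set` s] (f q) by rewrite -fs; exists q.
move=> /= fqs; have /tnthP[i fi] : f q \in in_tuple s by [].
by exists i; rewrite (xP i).2.
Qed.

Section frostman_content.
Context (R : realType) (P : Type) (Z : choiceType).
Variables (c : nat -> P -> Z) (b : nat -> R).
Hypothesis nested : forall i j x y, (i <= j)%N -> c j x = c j y -> c i x = c i y.
Hypothesis b0 : forall j, 0 <= b j.

(* The coarsest saturated cells are disjoint and cover [A]. *)
Lemma net_content_le_mass (A : set P) (J : nat) (I : finType) (x : I -> P) :
  (forall q, A q -> exists i, c J q = c J (x i)) ->
  exists w : I -> R, [/\ forall i, 0 <= w i,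
    forall j i, (j <= J)%N -> \sum_(i' | c j (x i') == c j (x i)) w i' <= b j &
    (net_content c b A <= (\sum_i w i)%:E)%E].
Proof.
move=> xA; pose d j i := c j (x i).
have dnested i j y z : (i <= j)%N -> d j y = d j z -> d i y = d i z by exact: nested.
have [w [w0 wb wsat]] := finite_frostman dnested b0 J.
exists w; split=> //; pose m := cell_mass d w.
have ex i : exists j, m j i == b j by have [j _ /eqP] := wsat i; exists j.
(* [lv i] is the coarsest level at which the cell of [i] is saturated. *)
pose lv i := ex_minn (ex i); pose phi i := (lv i, d (lv i) i).
have lvJ i : (lv i <= J)%N.
  rewrite /lv; case: ex_minnP => j _ jmin; have [l lJ /eqP/jmin] := wsat i.
  by move=> jl; exact: leq_trans lJ.
(* Points sharing the coarsest saturated cell have the same cells, hence the same masses, at all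
   coarser levels; so these cells are equal or disjoint. *)
have lvE i i' : d (lv i) i' = d (lv i) i -> lv i' = lv i.
  move=> dii'; have mE l : (l <= lv i)%N -> m l i' = m l i.
    by move=> li; exact: (eq_cell_mass dnested _ li).
  move: dii' mE; rewrite /lv; case: (ex_minnP (ex i)) => j jsat jmin dii' mE.
  case: ex_minnP => l lsat lmin; apply/eqP; rewrite eqn_leq.
  have lj : (l <= j)%N by apply: lmin; rewrite mE.
  by rewrite lj/= jmin// -mE.
pose U := [set q | exists i, q = phi i].
have UA : net_cover c U A.
  move=> q /xA[i qi]; exists (lv i), i.
  by rewrite /phi /d (nested (lvJ i) qi).
apply: (le_trans (net_content_le _ UA)).
apply: ge_ereal_sup => _ [F [finF FU] <-].
have [t ut Ft] : exists2 t : seq (nat * Z), uniq t & F = [set` t].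
  have /finite_seqP[t0 Ft0] := finF; exists (undup t0); first exact: undup_uniq.
  by rewrite Ft0; apply/seteqP; split=> q /=; rewrite mem_undup.
have tU q : q \in t -> U q by move=> qt; apply: FU; rewrite Ft.
rewrite Ft -fsbig_seq// sumEFin lee_fin.
(* By saturation the weight of each chosen cell is the mass it carries, and each [i] is counted at
   most once. *)
rewrite big_seq (eq_bigr (fun q => \sum_(i | phi i == q) w i)); last first.
  move=> q /tU[i ->] /=; have <- : m (lv i) i = b (lv i).
    by rewrite /lv; case: ex_minnP => j /eqP.
  apply: eq_bigl => i'; apply/eqP/eqP => [/[dup] dE /lvE e|[e]].
    by rewrite /phi e dE.
  by rewrite e.
rewrite -big_seq (exchange_big_dep xpredT)//=; apply: ler_sum => i _.
rewrite big_const_seq iter_addr addr0 (eq_count (a2 := pred1 (phi i))); last first.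
  by move=> q /=; rewrite eq_sym.
by rewrite count_uniq_mem//; case: (_ \in _); rewrite ?mulr1n ?mulr0n.
Qed.

(** The saturating weights have total mass above [a]; scaling them down to total mass [a] preserves
    the upper bounds on the cells. *)
Lemma discrete_frostman (A : set P) (J : nat) (a : R) : 0 < a ->
  finite_set (c J @` A) -> (a%:E < net_content c b A)%E ->
  exists p (x : 'I_p -> P) (w : 'I_p -> R), [/\ forall i, A (x i),
    forall i, 0 <= w i, \sum_i w i = a &
    forall j i, (j <= J)%N -> \sum_(i' | c j (x i') == c j (x i)) w i' <= b j].
Proof.
move=> a0 /finite_representatives[p [x [xA Ax]]] aA.
have [w [w0 wb Aw]] := net_content_le_mass Ax.
have : a < \sum_i w i by rewrite -lte_fin (lt_le_trans aA).
set W := \sum_i w i => aW; have W0 : 0 < W by exact: lt_trans aW.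
have aW1 : a / W <= 1 by rewrite ler_pdivrMr// mul1r ltW.
exists p, x, (fun i => (a / W) * w i); split=> // [i||j i jJ].
- by rewrite mulr_ge0// divr_ge0// ltW.
- by rewrite -mulr_sumr divfK// gt_eqF.
- rewrite -mulr_sumr; apply: le_trans (wb j i jJ).
  by rewrite ler_piMl// sumr_ge0.
Qed.

End frostman_content.

(** * Stars in a grid *)

Section grid.
Context (k D : nat).
Local Notation grid := {ffun 'I_k -> 'I_D}.

Definition upd (c : grid) (i : 'I_k) (u : 'I_D) : grid :=
  [ffun l => if l == i then u else c l].

Lemma upd_upd c i u v : upd (upd c i u) i v = upd c i v.
Proof. by apply/ffunP => l; rewrite !ffunE; case: eqP. Qed.

Lemma upd_id c i : upd c i (c i) = c.
Proof. by apply/ffunP => l; rewrite !ffunE; case: eqP => [->|]. Qed.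

Lemma upd_eq c i u : upd c i u i = u.
Proof. by rewrite ffunE eqxx. Qed.

Lemma upd_neq c i u l : l != i -> upd c i u l = c l.
Proof. by move=> li; rewrite ffunE (negPf li). Qed.

(** The map exchanging [u] with the [i]-th coordinate of [c] is an involution of the pairs
    [(c, u)]. *)
Lemma sum_upd (V : nmodType) (f : grid -> V) (i : 'I_k) :
  \sum_c \sum_u f (upd c i u) = (\sum_c f c) *+ D.
Proof.
pose h (p : grid * 'I_D) := (upd p.1 i p.2, p.1 i).
have hK : involutive h.
  by move=> [c u]; rewrite /h /= upd_upd upd_eq upd_id.
rewrite pair_big/= (reindex h)/=; last by apply: onW_bij; exact: inv_bij.
rewrite (eq_bigr (fun p => f p.1)); last first.
  by move=> [c u] _ /=; rewrite upd_upd upd_id.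
rewrite -(pair_big xpredT xpredT (fun c _ => f c))/=.
rewrite (eq_bigr (fun c => f c *+ D)) ?sumrMnl//.
by move=> c _; rewrite sumr_const card_ord.
Qed.

Context (R : realFieldType) (I : finType) (w : I -> R).
(** [r x c] is to be read as: [x] is captured at the grid parameter [c]. On each axis-parallel line,
    [sigma] bounds the proportion of near nodes, and [tau] is the proportion of far capturing nodes
    asked for. *)
Variables (r : I -> grid -> bool) (far : rel 'I_D) (rho sigma tau : R).
Hypothesis D0 : (0 < D)%N.
Hypothesis w0 : forall x, 0 <= w x.
Hypothesis rho0 : 0 < rho.
Hypothesis tau0 : 0 < tau.
Hypothesis near_count : forall v, #|[pred u | ~~ far v u]|%:R <= sigma * D%:R.
Hypothesis small : k%:R * (tau + sigma) * \sum_x w x <= rho / 2.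
Hypothesis dense : rho * D%:R ^+ k <= \sum_x \sum_(c | r x c) w x.

Let rich x (c : grid) i := tau * D%:R <= #|[pred u | far (c i) u & r x (upd c i u)]|%:R.

Let DR0 : 0 < D%:R :> R. Proof. by rewrite ltr0n. Qed.

Let sigma0 : 0 <= sigma.
Proof.
have := near_count (Ordinal D0).
by rewrite -(pmulr_lge0 _ DR0); apply: le_trans.
Qed.

(** On a line in direction [i] containing a poor node [v], fewer than [tau * D%:R] capturing nodes
    are far from [v], and at most [sigma * D%:R] nodes are near it. Summing over all lines counts
    each node [D] times. *)
Let poor_count x i :
  #|[pred c | r x c & ~~ rich x c i]|%:R <= (tau + sigma) * D%:R ^+ k.
Proof.
pose Q (c : grid) := r x c && ~~ rich x c i.
have QE : #|[pred c | r x c & ~~ rich x c i]|%:R = \sum_c (Q c)%:R :> R.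
  rewrite -sum1_card natr_sum big_mkcond/=; apply: eq_bigr => c _.
  by rewrite inE -/(Q c); case: (Q c).
rewrite -(ler_pM2r DR0) QE mulr_natr -(sum_upd _ i).
have cG : (#|{: grid}|%:R : R) = D%:R ^+ k by rewrite card_ffun !card_ord natrX.
rewrite mulrAC -cG mulr_natr -sumr_const; apply: ler_sum => c _.
have [/existsP[v Qv]|/existsPn nQ] := boolP [exists v, Q (upd c i v)]; last first.
  rewrite big1 => [|u _]; first by rewrite mulr_ge0 ?ler0n// addr_ge0// ltW.
  by rewrite (negPf (nQ u)).
have /andP[_] := Qv; rewrite /rich -ltNge upd_eq => poor.
rewrite mulrDl; apply: le_trans (lerD (ltW poor) (near_count v)).
rewrite -natrD -natr_sum ler_nat -!sum1_card.
rewrite [X in (_ <= X + _)%N]big_mkcond [X in (_ <= _ + X)%N]big_mkcond -big_split/=.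
apply: leq_sum => u _; rewrite !inE upd_upd /Q.
case: (far v u); last by rewrite leq_b1.
by case: (r x (upd c i u)); rewrite ?leq_b1.
Qed.

Let good x (c : grid) := r x c && [forall i, rich x c i].

Let good_dense : rho / 2 * D%:R ^+ k <= \sum_x \sum_(c | good x c) w x.
Proof.
pose bad i x (c : grid) := r x c && ~~ rich x c i.
have split_good : \sum_x \sum_(c | r x c) w x <=
    \sum_x \sum_(c | good x c) w x + \sum_i \sum_x \sum_(c | bad i x c) w x.
  rewrite [X in _ + X]exchange_big -big_split/=; apply: ler_sum => x _.
  rewrite (exchange_big_dep (r x))/=; last by move=> i c _ /andP[].
  rewrite (bigID (fun c => [forall i, rich x c i]))/= lerD2l.
  rewrite [leRHS](bigID (fun c => [forall i, rich x c i]))/= ler_wpDl//.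
    by apply: sumr_ge0 => c _; exact: sumr_ge0.
  apply: ler_sum => c /andP[rc /forallPn[i nr]].
  rewrite (bigD1 i)/=; last by rewrite /bad rc.
  by rewrite lerDl sumr_ge0.
have bad_small : \sum_i \sum_x \sum_(c | bad i x c) w x <= rho / 2 * D%:R ^+ k.
  apply: le_trans (ler_wpM2r _ small); last by rewrite exprn_ge0// ltW.
  rewrite -!mulrA mulr_natl -[X in _ *+ X]card_ord -sumr_const.
  apply: ler_sum => i _; rewrite mulrCA mulr_suml; apply: ler_sum => x _.
  rewrite sumr_const -[leLHS]mulr_natr; apply: ler_wpM2l => //.
  exact: poor_count.
have := le_trans dense split_good; move: bad_small; lra.
Qed.

(* A pair [(x, c)] with few far good neighbours on one of the axis-parallel lines
   through [c] is discarded; little mass is lost, and each remaining pair is the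
   centre of many stars. *)
Lemma exists_star : exists c u : grid, (forall i, far (c i) (u i)) /\
  rho / 2 * tau ^+ k <=
    \sum_(x | r x c && [forall i, r x (upd c i (u i))]) w x.
Proof.
pose star x (c u : grid) := r x c && [forall i, r x (upd c i (u i))].
pose isfar (c u : grid) := [forall i, far (c i) (u i)].
set v := rho / 2 * tau ^+ k.
have v0 : 0 < v by rewrite mulr_gt0 ?divr_gt0// exprn_gt0.
apply: contrapT => /forallNP none.
(* Averaging over centres [c] and tips [u]: if every star carried less than [v], the total would be
   less than [v] times the number of pairs. *)
pose S (c u : grid) := if isfar c u then \sum_(x | star x c u) w x else 0.
have Sv c u : S c u < v.
  rewrite /S; case: ifPn => // /forallP cu; rewrite ltNge; apply/negP => vS.
  by apply: (none c); exists u.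
have : \sum_c \sum_u S c u < v * D%:R ^+ k * D%:R ^+ k.
  have cG : (#|{: grid}|%:R : R) = D%:R ^+ k by rewrite card_ffun !card_ord natrX.
  have G0 : (0 < #|{: grid}|)%N by rewrite card_ffun !card_ord expn_gt0 D0.
  have /card_gt0P[c0 _] := G0.
  rewrite -cG mulr_natr -sumr_const; apply: ltr_sum => [|c _].
    by apply/hasP; exists c0; rewrite ?mem_index_enum.
  rewrite mulr_natr -sumr_const; apply: ltr_sum => [|u _]; last exact: Sv.
  by apply/hasP; exists c0; rewrite ?mem_index_enum.
apply/negP; rewrite -leNgt.
have -> : v * D%:R ^+ k * D%:R ^+ k = rho / 2 * D%:R ^+ k * (tau * D%:R) ^+ k.
  by rewrite exprMn /v; ring.
have tD0 : 0 <= (tau * D%:R) ^+ k by rewrite exprn_ge0// mulr_ge0// ltW.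
apply: le_trans (ler_wpM2r tD0 good_dense) _.
rewrite mulr_suml (eq_bigr (fun c => \sum_u \sum_(x | isfar c u && star x c u) w x)); last first.
  move=> c _; apply: eq_bigr => u _; rewrite /S; case: ifP => //= _.
  by rewrite big_pred0.
rewrite (eq_bigr (fun c => \sum_x \sum_(u | isfar c u && star x c u) w x)); last first.
  by move=> c _; rewrite (exchange_big_dep xpredT).
rewrite exchange_big/=; apply: ler_sum => x _; rewrite mulr_suml big_mkcond/=.
apply: ler_sum => c _; case: ifPn => [/andP[rc /forallP richc]|_]; last exact: sumr_ge0.
rewrite sumr_const -[leRHS]mulr_natr; apply: ler_wpM2l => //.
(* For a good pair the tips are chosen independently in each direction, with at least [tau * D%:R]
   choices each. *)
pose F i := [pred u | far (c i) u & r x (upd c i u)].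
have -> : #|[pred u | isfar c u & star x c u]| = #|(family F : pred grid)|.
  apply: eq_card => u; rewrite !inE /isfar /star rc /=.
  apply/andP/forallP => [[/forallP fu /forallP ru] i|Fu].
    by rewrite inE fu ru.
  by split; apply/forallP => i; have := Fu i; rewrite inE => /andP[].
rewrite card_family foldrE big_map big_enum/= natr_prod.
rewrite -[X in _ ^+ X]card_ord -prodr_const; apply: ler_prod => i _.
by rewrite mulr_ge0 ?(ltW tau0)//=; exact: richc.
Qed.

End grid.

(** * Dyadic cells *)

Section dyadic.
Context (R : realType) (m : nat).
Implicit Types (x y : 'rV[R]_m).

Definition cell (j : nat) x : 'rV[int]_m := \row_i Num.floor (2 ^+ j * x 0 i).

Lemma cell_nested i j x y : (i <= j)%N -> cell j x = cell j y -> cell i x = cell i y.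
Proof.
elim: j => [|j IH]; first by rewrite leqn0 => /eqP ->.
rewrite leq_eqVlt => /predU1P[->//|ij] xy; apply: IH => //.
apply/rowP => l; move/rowP/(_ l): xy; rewrite !mxE => xy.
have half (a b : R) : Num.floor (2 * a) = Num.floor (2 * b) -> Num.floor a <= Num.floor b.
  move=> ab; rewrite floor_ge_int; have := floor_le_tmp a.
  have : (2 * Num.floor a <= Num.floor (2 * a))%R.
    by rewrite floor_ge_int intrM ler_pM2l// floor_le_tmp.
  rewrite ab floor_ge_int intrM ler_pM2l//.
by apply/eqP; rewrite eq_le !half// !mulrA -!exprS.
Qed.

Lemma floor_dist (a b r : R) : `|a - b| <= r ->
  `|Num.floor a - Num.floor b| <= (Num.truncn r).+1%:Z.
Proof.
move=> abr; have : `|(Num.floor a - Num.floor b)%:~R| < (Num.truncn r).+2%:R :> R.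
  have := floor_itv a; have := floor_itv b; have := truncnS_gt r.
  rewrite -(natr1 (Num.truncn r).+1) rmorphB/= !intrD.
  move: abr; rewrite !ler_norml ltr_norml => /andP[r1 r2] r3 /andP[b1 b2] /andP[a1 a2].
  by apply/andP; split; lra.
rewrite -intr_norm -[X in _ < X]/((_.+2%:Z)%:~R) ltr_int -ltzD1 -addn1 PoszD.
by rewrite addrC.
Qed.

Lemma finite_cell_bounded (j : nat) (A : set 'rV[R]_m) (L : R) :
  (forall x, A x -> forall i, `|x 0 i| <= L) -> finite_set (cell j @` A).
Proof.
move=> AL; pose e := (Num.truncn (2 ^+ j * L)).+1.
pose g (f : {ffun 'I_m -> 'I_(2 * e).+1}) : 'rV[int]_m := \row_i ((f i)%:Z - e%:Z).
apply: (@sub_finite_set _ _ (g @` setT)); last exact/finite_image/finite_finset.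
move=> _ [x /AL xL <-].
exists [ffun i : 'I_m => inord (absz (cell j x 0 i + e%:Z))] => //.
apply/rowP => i; rewrite !mxE ffunE.
have : `|Num.floor (2 ^+ j * x 0 i) - Num.floor (0 : R)| <= e%:Z.
  by apply: floor_dist; rewrite subr0 normrM ger0_norm ?exprn_ge0// ler_pM2l ?exprn_gt0.
rewrite floor0 subr0 ler_norml => /andP[xe ex].
set z := Num.floor _ in xe ex *.
have ze : 0 <= z + e%:Z by rewrite -lerBlDr sub0r.
have -> : cell j x 0 i = z by rewrite mxE.
rewrite inordK; last by rewrite ltnS -lez_nat gez0_abs// mul2n -addnn PoszD lerD2r.
by rewrite gez0_abs// addrK.
Qed.

(** With [e] the truncation of [r] plus one, cells of level [j] that meet the set differ from a
    fixed one by at most [e] in each coordinate. This leaves at most [(2 * e).+1 ^ m] cells, and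
    [2 * e + 1] is at most [2 * r + 3]. *)
Lemma mass_small_set (I : finType) (x : I -> 'rV[R]_m) (w : I -> R) (Q : pred I)
    (j : nat) (b r : R) :
  (forall i, 0 <= w i) -> 0 <= b -> 0 <= r ->
  (forall i, \sum_(i' | cell j (x i') == cell j (x i)) w i' <= b) ->
  (forall i i' l, Q i -> Q i' -> `|x i 0 l - x i' 0 l| <= r * 2 ^- j) ->
  \sum_(i | Q i) w i <= (2 * r + 3) ^+ m * b.
Proof.
move=> w0 b0 r0 wb Qr; have [i0 Qi0|noQ] := pickP Q; last first.
  by rewrite big_pred0// mulr_ge0// exprn_ge0//; lra.
pose e := (Num.truncn r).+1.
pose phi i : {ffun 'I_m -> 'I_(2 * e).+1} :=
  [ffun l : 'I_m => inord (absz (cell j (x i) 0 l - cell j (x i0) 0 l + e%:Z))].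
have phi_inj i i' : Q i -> Q i' -> phi i = phi i' -> cell j (x i) = cell j (x i').
  move=> Qi Qi' /ffunP ii'; apply/rowP => l; have := congr1 val (ii' l).
  have bd i1 : Q i1 -> 0 <= cell j (x i1) 0 l - cell j (x i0) 0 l + e%:Z <= (2 * e)%:Z.
    move=> Qi1; have : `|cell j (x i1) 0 l - cell j (x i0) 0 l| <= e%:Z.
      rewrite !mxE; apply: floor_dist; rewrite -mulrBr normrM ger0_norm ?exprn_ge0//.
      by rewrite mulrC -ler_pdivlMr ?exprn_gt0// Qr.
    rewrite ler_norml mul2n -addnn PoszD lerD2r => /andP[h ->].
    by rewrite -lerBlDr sub0r h.
  have inK z : 0 <= z <= (2 * e)%:Z -> (inord (absz z) : 'I_(2 * e).+1) = absz z :> nat.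
    by move=> /andP[z0 ze]; rewrite inordK// ltnS -lez_nat gez0_abs.
  rewrite !ffunE /= !inK ?bd//; move=> /(congr1 Posz).
  have /andP[h _] := bd _ Qi; have /andP[h' _] := bd _ Qi'.
  by rewrite !gez0_abs// => /addIr/addIr.
rewrite (partition_big phi xpredT)//=.
apply: (@le_trans _ _ (\sum_(f : {ffun 'I_m -> 'I_(2 * e).+1}) b)).
  apply: ler_sum => f _.
  have [i /andP[Qi /eqP fi]|none] := pickP (fun i => Q i && (phi i == f)); last first.
    by rewrite big_pred0.
  apply: le_trans (wb i); rewrite [leRHS](bigID (fun i' => Q i' && (phi i' == f)))/=.
  rewrite ler_wpDr ?sumr_ge0//.
  rewrite [leRHS](eq_bigl (fun i' => Q i' && (phi i' == f)))// => i'.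
  case: (boolP (Q i' && _)) => [/andP[Qi' /eqP fi']|]; rewrite ?andbF// andbT.
  by apply/eqP/phi_inj => //; rewrite fi fi'.
rewrite sumr_const card_ffun !card_ord -[leLHS]mulr_natl natrX ler_wpM2r//.
rewrite lerXn2r ?nnegrE ?ler0n//; first by lra.
have := truncn_le r; rewrite r0 => re.
have eE : e%:R = (Num.truncn r)%:R + 1 :> R by rewrite natr1.
by rewrite -natr1 natrM eE; lra.
Qed.

(** The near [u] differ from [v] by at most the truncation of [s], which leaves at most [2 * s + 1]
    values, hence at most [3 * s] as [s] is at least 1. *)
Lemma near_ord_count (D : nat) (s : R) (v : 'I_D) : 1 <= s ->
  #|[pred u : 'I_D | ~~ (s <= `|v%:R - u%:R|)]|%:R <= 3 * s.
Proof.
move=> s1; pose e := Num.truncn s.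
have s0 : 0 <= s by lra.
have near (u : 'I_D) : ~~ (s <= `|v%:R - u%:R|) -> (v <= u + e)%N && (u <= v + e)%N.
  rewrite -ltNge ltr_norml => /andP[h1 h2]; have := truncnS_gt s; rewrite -/e => se.
  by apply/andP; split; rewrite -ltnS -(ltr_nat R) -addnS natrD; lra.
pose f (u : 'I_D) : 'I_(2 * e).+1 := inord (u + e - v).
have fE (u : 'I_D) : ~~ (s <= `|v%:R - u%:R|) -> f u = (u + e - v)%N :> nat.
  by move=> /near/andP[vu uv]; rewrite /f inordK// ltnS; lia.
have finj : {in [pred u : 'I_D | ~~ (s <= `|v%:R - u%:R|)] &, injective f}.
  move=> u u'; rewrite !inE => nu nu' /(congr1 val); rewrite /= !fE//.
  move: (near _ nu) (near _ nu') => /andP[h1 h2] /andP[h3 h4] h.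
  by apply/val_inj => /=; lia.
rewrite -(card_in_image finj); apply: (@le_trans _ _ (2 * e).+1%:R).
  by rewrite ler_nat -[leqRHS]card_ord max_card.
have := truncn_le s; rewrite s0 -/e => se; rewrite -natr1 natrM; lra.
Qed.

End dyadic.

(* Differences along the rays of the star isolate each [v_i], and then [v_0]. *)
Lemma star_solve (R : realFieldType) (k : nat) (v0 : R) (v : 'I_k -> R)
    (t0 : 'I_k -> R) (t : 'I_k -> 'I_k -> R) (d eta h B M : R) :
  0 < eta -> 0 <= d -> 0 <= B -> 0 <= h -> 0 <= M -> k%:R * (h * M) <= d ->
  (forall l, `|v l| <= M) -> (forall l, `|t0 l| <= B) ->
  (forall i l, l != i -> `|t i l - t0 l| <= h) ->
  (forall i, eta <= `|t i i - t0 i|) ->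
  `|v0 + \sum_l t0 l * v l| <= 4 * d ->
  (forall i, `|v0 + \sum_l t i l * v l| <= 4 * d) ->
  (forall i, `|v i| <= 9 * d / eta) /\ `|v0| <= 4 * d + k%:R * (B * (9 * d / eta)).
Proof.
move=> eta0 d0 B0 h0 M0 hM vM t0B th teta p0 p.
have sum_le (f : 'I_k -> R) (Q : pred 'I_k) (c : R) : 0 <= c ->
    (forall l, Q l -> `|f l| <= c) -> `|\sum_(l | Q l) f l| <= k%:R * c.
  move=> c0 fc; apply: le_trans (ler_norm_sum _ _ _) _.
  apply: (@le_trans _ _ (\sum_(l < k) c)); last by rewrite sumr_const card_ord mulr_natl.
  by rewrite big_mkcond; apply: ler_sum => l _; case: ifPn => // /fc.
have vd i : `|v i| <= 9 * d / eta.
  rewrite ler_pdivlMr//; apply: le_trans (ler_wpM2l (normr_ge0 _) (teta i)) _.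
  rewrite -normrM.
  have -> : v i * (t i i - t0 i) = (v0 + \sum_l t i l * v l) - (v0 + \sum_l t0 l * v l)
      - \sum_(l | l != i) (t i l - t0 l) * v l.
    rewrite (bigD1 i)//= [X in _ - (_ + X)](bigD1 i)//=.
    under [X in _ = _ - X]eq_bigr do rewrite mulrBl.
    rewrite sumrB; ring.
  apply: le_trans (ler_normB _ _) _.
  have := le_trans (ler_normB (v0 + \sum_l t i l * v l) (v0 + \sum_l t0 l * v l))
    (lerD (p i) p0).
  have : `|\sum_(l | l != i) (t i l - t0 l) * v l| <= d.
    apply: le_trans hM; apply: sum_le; first exact: mulr_ge0.
    by move=> l /th tl; rewrite normrM ler_pM.
  lra.
split=> //.
have -> : v0 = (v0 + \sum_l t0 l * v l) - \sum_l t0 l * v l by rewrite addrK.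
apply: le_trans (ler_normB _ _) _; apply: lerD => //.
apply: sum_le => [|l _]; last by rewrite normrM ler_pM.
by apply: mulr_ge0 => //; apply: divr_ge0; [exact: mulr_ge0|exact: ltW].
Qed.

(** * Mass captured by all the parameters of a star *)

Section star_mass.
Context (R : realType) (n k : nat).
Implicit Types (t : k.-tuple R) (x : 'rV[R]_(k.+1 * n)).

Lemma block_projE t x c : block_proj t x 0 c =
  vec_mx x ord0 c + \sum_(i < k) tnth t i * vec_mx x (lift ord0 i) c.
Proof.
rewrite /block_proj !mxE summxE; congr (_ + _).
by apply: eq_bigr => i _; rewrite !mxE.
Qed.

(** Two points projected into the same ball for every parameter have projections differing by at
    most [4 * d]; [star_solve] applies to each coordinate of the difference of their blocks. *)
Lemma star_diameter (t : 'I_k.+1 -> k.-tuple R) (y : 'I_k.+1 -> 'rV[R]_n)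
    (d eta h B L : R) x x' :
  0 < eta -> 0 <= d -> 0 <= B -> 0 <= h -> 0 <= L -> k%:R * (h * (2 * L)) <= d ->
  (forall l, `|x 0 l| <= L) -> (forall l, `|x' 0 l| <= L) ->
  (forall l, `|tnth (t ord0) l| <= B) ->
  (forall i l, l != i -> `|tnth (t (lift ord0 i)) l - tnth (t ord0) l| <= h) ->
  (forall i, eta <= `|tnth (t (lift ord0 i)) i - tnth (t ord0) i|) ->
  (forall s c, `|(block_proj (t s) x - y s) 0 c| < 2 * d) ->
  (forall s c, `|(block_proj (t s) x' - y s) 0 c| < 2 * d) ->
  forall l, `|x 0 l - x' 0 l| <= (4 + 9 / eta + k%:R * (B * (9 / eta))) * d.
Proof.
move=> eta0 d0 B0 h0 L0 hL xL xL' tB th teta xy xy' l.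
case/mxvec_indexP: l => i c.
have vE (z : 'rV[R]_(k.+1 * n)) i' : z 0 (mxvec_index i' c) = vec_mx z i' c.
  by rewrite mxE.
pose v i' := vec_mx x i' c - vec_mx x' i' c.
have proj s : `|v ord0 + \sum_l tnth (t s) l * v (lift ord0 l)| <= 4 * d.
  have bE z : (block_proj (t s) z - y s) 0 c = block_proj (t s) z 0 c - y s 0 c.
    by rewrite [LHS]mxE [X in _ + X]mxE.
  have -> : v ord0 + \sum_l tnth (t s) l * v (lift ord0 l) =
      (block_proj (t s) x - y s) 0 c - (block_proj (t s) x' - y s) 0 c.
    rewrite !bE !block_projE /v; under eq_bigr do rewrite mulrBr.
    by rewrite sumrB; ring.
  apply: le_trans (ler_normB _ _) _.
  by have := ltrD (xy s c) (xy' s c) => /ltW; lra.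
have vL i' : `|v i'| <= 2 * L.
  apply: le_trans (ler_normB _ _) _; rewrite -!vE.
  by have := lerD (xL (mxvec_index i' c)) (xL' (mxvec_index i' c)); lra.
have L20 : 0 <= 2 * L by rewrite mulr_ge0.
have [vi v0] := star_solve eta0 d0 B0 h0 L20 hL (fun l => vL (lift ord0 l))
  tB th teta (proj ord0) (fun i => proj (lift ord0 i)).
rewrite !vE -/(v i).
have q0 : 0 <= 9 / eta by rewrite divr_ge0// ltW.
have kq0 : 0 <= k%:R * (B * (9 / eta)) * d.
  by do 2?[apply: mulr_ge0 => //]; exact: mulr_ge0.
have qE : 9 * d / eta = 9 / eta * d by rewrite mulrAC.
case: (unliftP ord0 i) => [i' ->|->].
  by apply: le_trans (vi i') _; rewrite qE; lra.
apply: le_trans v0 _; rewrite qE.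
have := mulr_ge0 q0 d0; lra.
Qed.

(** The weight bound allows at most [P ^+ j] balls of level [j] per parameter. Sorting the points by
    the [k.+1] balls that capture them gives at most [(P ^+ j) ^+ k.+1] classes, each of diameter of
    order [2 ^- j]. *)
Lemma star_mass (I : finType) (x : I -> 'rV[R]_(k.+1 * n)) (w : I -> R) (Q : pred I)
    (N j : nat) (t : 'I_k.+1 -> k.-tuple R) (y : 'I_k.+1 -> 'I_N.+1 -> 'rV[R]_n)
    (lv : 'I_k.+1 -> 'I_N.+1 -> nat) (P b eta h B L : R) :
  0 < P -> 0 <= b -> (forall i, 0 <= w i) ->
  (forall i, \sum_(i' | cell j (x i') == cell j (x i)) w i' <= b) ->
  (forall i l, `|x i 0 l| <= L) ->
  0 < eta -> 0 <= B -> 0 <= h -> 0 <= L -> k%:R * (h * (2 * L)) <= 2 ^- j ->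
  (forall l, `|tnth (t ord0) l| <= B) ->
  (forall i l, l != i -> `|tnth (t (lift ord0 i)) l - tnth (t ord0) l| <= h) ->
  (forall i, eta <= `|tnth (t (lift ord0 i)) i - tnth (t ord0) i|) ->
  (forall s, \sum_i P ^- lv s i <= 1) ->
  (forall i, Q i -> forall s, exists2 l, lv s l = j &
    forall c, `|(block_proj (t s) (x i) - y s l) 0 c| < 2 * 2 ^- j) ->
  \sum_(i | Q i) w i <=
    (P ^+ j) ^+ k.+1 * ((2 * (4 + 9 / eta + k%:R * (B * (9 / eta))) + 3) ^+ (k.+1 * n) * b).
Proof.
move=> P0 b0 w0 wb xL eta0 B0 h0 L0 hL tB th teta lvP Qy.
set r := 4 + _ + _.
have q0 : 0 <= 9 / eta by rewrite divr_ge0// ltW.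
have r0 : 0 <= r.
  by rewrite !addr_ge0//; apply: mulr_ge0 => //; exact: mulr_ge0.
have /choice[psi psiP] i : exists f : {ffun 'I_k.+1 -> 'I_N.+1}, Q i ->
    forall s, lv s (f s) = j /\
      forall c, `|(block_proj (t s) (x i) - y s (f s)) 0 c| < 2 * 2 ^- j.
  have [Qi|] := boolP (Q i); last by exists [ffun=> ord0].
  have /choice[f fP] s : exists l, lv s l = j /\
      forall c, `|(block_proj (t s) (x i) - y s l) 0 c| < 2 * 2 ^- j.
    by have [l] := Qy i Qi s; exists l.
  by exists (finfun f) => _ s; rewrite ffunE.
pose F s := [pred l | lv s l == j].
have Fcard s : #|F s|%:R <= P ^+ j.
  rewrite -[leLHS]mulr1 -[leRHS]mul1r -ler_pdivrMr ?exprn_gt0// -mulrA mul1r.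
  apply: le_trans (lvP s); rewrite mulr_natl -sumr_const.
  rewrite [leRHS](bigID (fun l => l \in F s))/= ler_wpDr//.
    by apply: sumr_ge0 => l _; rewrite invr_ge0 exprn_ge0// ltW.
  by apply: ler_sum => l; rewrite inE => /eqP ->.
have psiF i : Q i -> psi i \in family F.
  by move=> Qi; apply/familyP => s; rewrite inE (psiP i Qi s).1.
rewrite (partition_big psi (fun f => f \in family F))//=.
apply: (@le_trans _ _ (\sum_(f in family F) ((2 * r + 3) ^+ (k.+1 * n) * b))).
  apply: ler_sum => f _; apply: (@mass_small_set _ _ _ x w _ j b r) => //.
  move=> i i' l /andP[Qi /eqP fi] /andP[Qi' /eqP fi'].
  apply: (@star_diameter t (fun s => y s (f s)) _ eta h B L) => //.
  - by move=> s c; have := (psiP i Qi s).2; rewrite fi.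
  - by move=> s c; have := (psiP i' Qi' s).2; rewrite fi'.
rewrite sumr_const -[leLHS]mulr_natl ler_wpM2r//.
  by rewrite mulr_ge0// exprn_ge0//; lra.
rewrite card_family foldrE big_map big_enum/= natr_prod.
rewrite -[X in _ ^+ X]card_ord -prodr_const; apply: ler_prod => s _.
by rewrite ler0n Fcard.
Qed.

End star_mass.

(** * Counting parameters *)

Lemma exprn_eventually_small (R : realType) (z e : R) : 0 <= z -> z < 1 -> 0 < e ->
  exists j0, forall j, (j0 <= j)%N -> z ^+ j < e.
Proof.
move=> z0 z1 e0; have : (GRing.exp z) @ \oo --> (0 : R).
  by apply: cvg_expr; rewrite ger0_norm.
move=> /cvgr0Pnorm_lt/(_ e e0)[j0 _ j0P]; exists j0 => j /j0P.
by rewrite ger0_norm// exprn_ge0.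
Qed.

Section counting.
Context (R : realType) (n k : nat).
Local Notation m := (k.+1 * n)%N.
Variables (P beta theta L B a eps : R).
Hypotheses (k0 : (0 < k)%N) (P0 : 0 < P) (beta0 : 0 < beta)
  (theta0 : 0 < theta) (theta1 : theta < 1) (L0 : 0 <= L) (B0 : 0 <= B)
  (a0 : 0 < a) (eps0 : 0 < eps) (eps1 : eps <= 1)
  (gap : P ^+ k.+1 * beta < theta ^+ (m + k.+1)).

(** A finite form of the covering condition [thin] below, with captures at levels from [j0] to [N]
    only. The indices run up to [N], so that the single number [N] bounds both their number and the
    levels used. *)
Definition good_cover (j0 N : nat) (A : set 'rV[R]_m) (t : k.-tuple R) :=
  exists (y : 'I_N.+1 -> 'rV[R]_n) (lv : 'I_N.+1 -> nat),
    [/\ forall i, (j0 <= lv i)%N, \sum_i P ^- lv i <= 1 &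
      forall x, A x -> exists2 i, (lv i <= N)%N &
        forall c, `|(block_proj t x - y i) 0 c| < 2 * 2 ^- lv i].

(** Chosen so that the numbers [8 * k%:R * a * eta j] have total at most [eps * a] over all levels,
    as the pigeonhole in [counting] requires. *)
Let eta0 : R := eps * (1 - theta) / (8 * k%:R).
Let eta j : R := eta0 * theta ^+ j.
(** Bounds [eta j] times the diameter constant of [star_mass] at separation [eta j / 2], that is,
    [11 * eta j + 36 + 36 * k%:R * B]. *)
Let C : R := 47 + 36 * k%:R * B.

Let kR0 : 0 < k%:R :> R. Proof. by rewrite ltr0n. Qed.

Let eta0_gt0 : 0 < eta0.
Proof. by rewrite divr_gt0// ?mulr_gt0// subr_gt0. Qed.

Let eta_gt0 j : 0 < eta j.
Proof. by rewrite mulr_gt0// exprn_gt0. Qed.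

Let eta_le1 j : eta j <= 1.
Proof.
apply: (@le_trans _ _ eta0); first by rewrite ler_piMr ?exprn_ile1// ltW.
rewrite ler_pdivrMr ?mulr_gt0// mul1r.
have k1 : 1 <= k%:R :> R by rewrite ler1n.
have : eps * (1 - theta) <= 1 * 1.
  by apply: ler_pM; move: eps0 eps1 theta0 theta1; lra.
lra.
Qed.

Let eta_anti i j : (i <= j)%N -> eta j <= eta i.
Proof.
move=> ij; rewrite ler_pM2l//; apply: ler_wiXn2l => //; exact: ltW.
Qed.

(* The mass bound of [star_mass] against the lower bound of [exists_star]. *)
Let level_contradiction : exists j0, forall j, (j0 <= j)%N ->
  (P ^+ j) ^+ k.+1 *
    ((2 * (4 + 9 / (eta j / 2) + k%:R * (B * (9 / (eta j / 2)))) + 3) ^+ m * beta ^+ j)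
  < 4 * k%:R * a * eta j * eta j ^+ k.
Proof.
(* Once both sides are multiplied by [eta j ^+ m], the left grows at most like
   [(P ^+ k.+1 * beta) ^+ j], and the right like the [j]-th power of [theta ^+ (m + k.+1)]; [z] is
   the ratio. *)
pose z := P ^+ k.+1 * beta / theta ^+ (m + k.+1).
have thm : 0 < theta ^+ (m + k.+1) by rewrite exprn_gt0.
have z0 : 0 <= z by rewrite divr_ge0 ?mulr_ge0// ?exprn_ge0// ltW.
have z1 : z < 1 by rewrite ltr_pdivrMr// mul1r.
have C0 : 0 < C by rewrite ltr_pwDl// !mulr_ge0// ltW.
pose e := 4 * k%:R * a * eta0 ^+ (m + k.+1) / C ^+ m.
have e0 : 0 < e by rewrite divr_gt0 ?mulr_gt0// ?exprn_gt0.
have [j0 j0P] := exprn_eventually_small z0 z1 e0; exists j0 => j /j0P {j0P}.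
have ej := eta_gt0 j.
have CE : 2 * (4 + 9 / (eta j / 2) + k%:R * (B * (9 / (eta j / 2)))) + 3 <= C / eta j.
  rewrite ler_pdivlMr//.
  have -> : (2 * (4 + 9 / (eta j / 2) + k%:R * (B * (9 / (eta j / 2)))) + 3) * eta j =
    11 * eta j + 36 + 36 * k%:R * B by field; rewrite gt_eqF.
  by have := eta_le1 j; rewrite /C; lra.
rewrite /z expr_div_n ltr_pdivrMr ?exprn_gt0// => ze.
have h1 : 0 < eta j ^+ m by rewrite exprn_gt0.
rewrite -(ltr_pM2r h1).
apply: (@le_lt_trans _ _ (C ^+ m * (P ^+ k.+1 * beta) ^+ j)).
  have E (u v X y : R) : u * (X ^+ m * v) * y ^+ m = u * v * (X * y) ^+ m.
    by rewrite exprMn; ring.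
  rewrite E.
  have PE : (P ^+ k.+1 * beta) ^+ j = (P ^+ j) ^+ k.+1 * beta ^+ j.
    by rewrite exprMn -!exprM mulnC.
  rewrite PE [leRHS]mulrC ler_wpM2l//.
    by rewrite ltW// mulr_gt0// ?exprn_gt0// exprn_gt0.
  have kB : 0 <= k%:R * (B * (9 / (eta j / 2))).
    by do 2?[apply: mulr_ge0 => //]; rewrite divr_ge0// divr_ge0// ltW.
  have k9 : 0 <= 9 / (eta j / 2) by rewrite divr_ge0// divr_ge0// ltW.
  rewrite lerXn2r ?nnegrE//; first by rewrite mulr_ge0//; [lra|exact: ltW].
  - exact: ltW.
  - by rewrite -ler_pdivlMr.
rewrite mulrC -ltr_pdivlMr ?exprn_gt0//; apply: lt_le_trans ze _.
rewrite /e le_eqVlt; apply/orP; left; apply/eqP.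
have etaE : eta j ^+ (m + k.+1) = eta0 ^+ (m + k.+1) * (theta ^+ (m + k.+1)) ^+ j.
  by rewrite exprMn -!exprM [(j * _)%N]mulnC.
have -> : 4 * k%:R * a * eta j * eta j ^+ k * eta j ^+ m =
    4 * k%:R * a * eta j ^+ (m + k.+1) by rewrite exprD exprS; ring.
by rewrite etaE; ring.
Qed.

(** [j0] is chosen before [A], [N] and [p], whereas the fineness [D] of the grid may depend on them.
    [S] is a set of grid cells containing a parameter with a good cover, and the conclusion bounds
    its proportion by [eps]. *)
Lemma counting : exists j0, forall (A : set 'rV[R]_m) (N : nat) (p : 'I_k -> R),
  (forall l, `|p l| + 1 <= B) ->
  (forall x, A x -> forall l, `|x 0 l| <= L) ->
  (a%:E < net_content (@cell R m) (fun j => beta ^+ j)%R A)%E ->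
  exists2 D, (0 < D)%N & forall S : {set {ffun 'I_k -> 'I_D}},
    (forall c, c \in S -> exists2 t, good_cover j0 N A t &
      forall l, p l + (c l)%:R / D%:R <= tnth t l <= p l + (c l).+1%:R / D%:R) ->
    #|S|%:R <= eps * D%:R ^+ k.
Proof.
have [j0 j0P] := level_contradiction; exists j0 => A N p pB AL aA.
have beta_ge0 j : 0 <= beta ^+ j by rewrite exprn_ge0// ltW.
have [q [x [w [xA w0 wa wb]]]] := discrete_frostman (@cell_nested R m) beta_ge0 a0
  (finite_cell_bounded N AL) aA.
(* The first term makes the mesh at most half of every separation [eta j] with [j] up to [N]; the
   second makes the error from off-axis coordinates at most [2 ^- N]. *)
have [D Dn0 dN] : exists2 D, (0 < D)%N & 2 / eta N + 2 * k%:R * L * 2 ^+ N < D%:R.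
  exists (Num.truncn (2 / eta N + 2 * k%:R * L * 2 ^+ N)).+1 => //.
  exact: truncnS_gt.
have eN := eta_gt0 N.
have tN0 : 0 <= 2 * k%:R * L * 2 ^+ N by rewrite !mulr_ge0 ?exprn_ge0.
have e20 : 0 <= 2 / eta N by rewrite divr_ge0// ltW.
have D0 : 0 < D%:R :> R by rewrite ltr0n.
have D2 : 2 <= eta N * D%:R by rewrite mulrC -ler_pdivrMr//; lra.
have DL j : (j <= N)%N -> k%:R * (D%:R^-1 * (2 * L)) <= 2 ^- j.
  move=> jN; apply: (@le_trans _ _ (2 ^- N)); last first.
    by rewrite lef_pV2 ?posrE ?exprn_gt0// ler_weXn2l// ler1n.
  rewrite -[leRHS]mul1r ler_pdivlMr ?exprn_gt0//.
  rewrite [leLHS](_ : _ = 2 * k%:R * L * 2 ^+ N / D%:R); last by ring.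
  by rewrite ler_pdivrMr// mul1r; lra.
exists D => // S SP; rewrite leNgt; apply/negP => Sbig.
have /choice[t tP] (c : {ffun 'I_k -> 'I_D}) : exists t, c \in S -> good_cover j0 N A t /\
    forall l, p l + (c l)%:R / D%:R <= tnth t l <= p l + (c l).+1%:R / D%:R.
  have [/SP[t ? ?]|] := boolP (c \in S); first by exists t.
  by exists [tuple of nseq k 0].
have /choice[ylv ylvP] (c : {ffun 'I_k -> 'I_D}) :
    exists ylv : ('I_N.+1 -> 'rV[R]_n) * ('I_N.+1 -> nat), c \in S ->
    [/\ forall i, (j0 <= ylv.2 i)%N, \sum_i P ^- ylv.2 i <= 1 &
      forall x, A x -> exists2 i, (ylv.2 i <= N)%N &
        forall c', `|(block_proj (t c) x - ylv.1 i) 0 c'| < 2 * 2 ^- ylv.2 i].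
  have [cS|] := boolP (c \in S); last by exists (fun=> 0, fun=> 0%N).
  by have [[y [lv ?]] _] := tP c cS; exists (y, lv).
pose r (j : nat) (i : 'I_q) (c : {ffun 'I_k -> 'I_D}) := (c \in S) &&
  [exists l, ((ylv c).2 l == j) && [forall s,
    `|(block_proj (t c) (x i) - (ylv c).1 l) 0 s| < 2 * 2 ^- j]].
(* With [tau = eta j] and [sigma = 3 * eta j], discarding poor pairs loses at most
   [4 * k%:R * a * eta j], which is half of [rho j]. *)
pose rho j := 8 * k%:R * a * eta j.
have rho0 j : 0 < rho j by rewrite /rho; do 2?[apply: mulr_gt0 => //]; rewrite mulr_gt0.
(* Pigeonhole over levels: each point is captured at some level for each parameter of [S], and no
   capture has level below [j0]. If every level were sparse, the total mass would be less than
   [eps * D%:R ^+ k * a]. *)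
have [j jN dense] : exists2 j : 'I_N.+1, (j0 <= j)%N &
    rho j * D%:R ^+ k <= \sum_i \sum_(c | r j i c) w i.
  apply: contrapT => none.
  have small (j : 'I_N.+1) : \sum_i \sum_(c | r j i c) w i <= rho j * D%:R ^+ k.
    have [jj0|jj0] := leqP j0 j.
      by rewrite leNgt; apply/negP => /ltW h; apply: none; exists j.
    rewrite big1 => [|i _]; first by rewrite ltW// mulr_gt0// exprn_gt0.
    rewrite big_pred0// => c; apply/negP => /andP[cS /existsP[l /andP[/eqP lj _]]].
    by have [/(_ l)] := ylvP c cS; rewrite lj leqNgt jj0.
  have : #|S|%:R * a <= \sum_(j < N.+1) \sum_i \sum_(c | r j i c) w i.
    rewrite -wa mulr_natl -sumr_const exchange_big/=.
    rewrite [leRHS]exchange_big/=; apply: ler_sum => i _.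
    rewrite (exchange_big_dep (fun c => c \in S))/=; last by move=> j c _ /andP[].
    apply: ler_sum => c cS; have [_ _ /(_ _ (xA i))[l lN lP]] := ylvP c cS.
    rewrite -ltnS in lN.
    rewrite (bigD1 (Ordinal lN))/=; last first.
      rewrite /r cS; apply/existsP; exists l; rewrite eqxx/=.
      by apply/forallP => s; exact: lP.
    by rewrite lerDl sumr_ge0.
  apply/negP; rewrite -ltNge.
  apply: (@le_lt_trans _ _ (\sum_(j < N.+1) rho j * D%:R ^+ k)); first exact: ler_sum.
  apply: (@le_lt_trans _ _ (eps * D%:R ^+ k * a)); last by rewrite ltr_pM2r.
  rewrite -mulr_suml -mulr_sumr -mulr_sumr.
  have -> : eps * D%:R ^+ k * a = eps * a * D%:R ^+ k by rewrite mulrAC.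
  rewrite ler_wpM2r ?exprn_ge0//.
  have := subrX1 theta N.+1; set T := \sum_(_ < _) _ => TE.
  have -> : 8 * k%:R * a * (eta0 * T) = eps * a * ((1 - theta) * T).
    by rewrite /eta0; field; rewrite gt_eqF.
  rewrite ler_piMr//; first by rewrite mulr_ge0 ?ltW.
  have -> : (1 - theta) * T = 1 - theta ^+ N.+1 by rewrite -[RHS]opprB TE; ring.
  by rewrite gerBl exprn_ge0// ltW.
have jN' : (j <= N)%N by rewrite -ltnS.
have ej := eta_gt0 j.
have D2j : 2 <= eta j * D%:R.
  by apply: le_trans D2 _; rewrite ler_pM2r// eta_anti.
have Dh : D%:R^-1 <= eta j / 2.
  by rewrite -[leLHS]mul1r ler_pdivrMr// mulrAC ler_pdivlMr// mul1r.
pose far (v u : 'I_D) := eta j * D%:R <= `|v%:R - u%:R|.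
have near_count v : #|[pred u | ~~ far v u]|%:R <= 3 * eta j * D%:R.
  by rewrite -mulrA; apply: near_ord_count; lra.
have small : k%:R * (eta j + 3 * eta j) * \sum_i w i <= rho j / 2.
  by rewrite wa /rho le_eqVlt; apply/orP; left; apply/eqP; field.
have [c [u [cu]]] := exists_star Dn0 w0 (rho0 j) ej near_count small dense.
(* Index [ord0] is the centre of the star, and index [lift ord0 i] its tip in direction [i]. *)
pose pt s := if unlift ord0 s is Some i then upd c i (u i) else c.
have pt0 : pt ord0 = c by rewrite /pt unlift_none.
have ptS i : pt (lift ord0 i) = upd c i (u i) by rewrite /pt liftK.
pose Q i := r j i c && [forall i', r j i (upd c i' (u i'))] => massQ.
have Qr i s : Q i -> r j i (pt s).
  move=> /andP[rc /forallP ru]; case: (unliftP ord0 s) => [l ->|->].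
    by rewrite ptS; exact: ru.
  by rewrite pt0.
have mass0 : 0 < rho j / 2 * eta j ^+ k by rewrite mulr_gt0 ?divr_gt0// exprn_gt0.
(* A point captured by the whole star shows that all its nodes are in [S], the only nodes where [t]
   is controlled. *)
have [i0 Qi0|noQ] := pickP Q; last by move: massQ; rewrite big_pred0// leNgt mass0.
have ptin s : pt s \in S by have /andP[] := Qr i0 s Qi0.
have tpt s := (tP _ (ptin s)).2.
have := j0P j jN; apply/negP; rewrite -leNgt.
have -> : 4 * k%:R * a * eta j * eta j ^+ k = rho j / 2 * eta j ^+ k.
  by rewrite /rho; field.
apply: (le_trans massQ).
have e2 : 0 < eta j / 2 by rewrite divr_gt0.
apply: (@star_mass _ n k _ x w Q N j (fun s => t (pt s)) (fun s => (ylv (pt s)).1)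
  (fun s => (ylv (pt s)).2) P (beta ^+ j) (eta j / 2) D%:R^-1 B L) => //.
- by move=> i; exact: wb.
- by move=> i; exact: AL.
- exact: DL.
- move=> l; rewrite pt0; have := tpt ord0 l; rewrite pt0 => /andP[h1 h2].
  have c0 : 0 <= (c l)%:R / D%:R :> R by rewrite divr_ge0// ltW.
  have c1 : (c l).+1%:R / D%:R <= 1 :> R by rewrite ler_pdivrMr// mul1r ler_nat.
  have := pB l; have := ler_norm (p l); have := lerNnormlW (lexx `|p l|).
  rewrite ler_norml => h3 h4 h5; apply/andP; split; lra.
- move=> i l li; rewrite ptS pt0.
  have := tpt (lift ord0 i) l; rewrite ptS upd_neq// => /andP[h1 h2].
  have := tpt ord0 l; rewrite pt0 => /andP[h3 h4].
  move: h1 h2 h3 h4; rewrite -[(c l).+1%:R]natr1 mulrDl mul1r => h1 h2 h3 h4.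
  by rewrite ler_norml; apply/andP; split; lra.
- move=> i; rewrite ptS pt0.
  have := tpt (lift ord0 i) i; rewrite ptS upd_eq => /andP[h1 h2].
  have := tpt ord0 i; rewrite pt0 => /andP[h3 h4].
  move: h1 h2 h3 h4; rewrite -[(u i).+1%:R]natr1 -[(c i).+1%:R]natr1 !mulrDl mul1r.
  move=> h1 h2 h3 h4.
  (* Each parameter lies within [D%:R^-1] of its node, so nodes [eta j] apart give parameters at
     least [eta j / 2] apart. *)
  have : eta j <= `|(c i)%:R / D%:R - (u i)%:R / D%:R|.
    rewrite -mulrBl normrM [X in _ * X]ger0_norm ?invr_ge0 ?(ltW D0)//.
    by rewrite ler_pdivlMr//; exact: cu.
  rewrite !ler_normr => /orP[h|h]; apply/orP; [right|left]; lra.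
- by move=> s; have [] := ylvP _ (ptin s).
- move=> i Qi s; have /andP[_ /existsP[l /andP[/eqP lj /forallP lP]]] := Qr i s Qi.
  by exists l.
Qed.

End counting.

(** * Covers of parameter sets *)

Section negligible_liminf.
Context d (T : measurableType d) (R : realType).
Variable mu : {measure set T -> \bar R}.

Lemma negligible_small_covers (A : set T) :
  (forall e : R, 0 < e -> exists2 B, measurable B & A `<=` B /\ (mu B <= e%:E)%E) ->
  mu.-negligible A.
Proof.
move=> Ae; have /choice[B BP] (i : nat) : exists B, [/\ measurable B, A `<=` B &
    (mu B <= (i.+1%:R^-1)%:E)%E].
  have [|B mB [AB Be]] := Ae i.+1%:R^-1; first by rewrite invr_gt0.
  by exists B.
have mB : measurable (\bigcap_i B i).
  by apply: bigcap_measurable => // i _; have [] := BP i.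
exists (\bigcap_i B i); split=> //; last by move=> x Ax i _; have [_ + _] := BP i; apply.
apply/eqP; rewrite eq_le measure_ge0 andbT; apply/lee_addgt0Pr => e e0; rewrite add0e.
have [i ie] : exists i, i.+1%:R^-1 <= e.
  exists (Num.truncn e^-1); rewrite invf_ple ?posrE//; exact/ltW/truncnS_gt.
have [mBi _ Bi] := BP i.
apply: (@le_trans _ _ (mu (B i))).
  by apply: le_measure; rewrite ?inE//; exact: bigcap_inf.
by apply: le_trans Bi _; rewrite lee_fin.
Qed.

(* Continuity from below of the outer measure, along a liminf. *)
Lemma liminf_cover (A : set T) (An : nat -> set T) (e : R) :
  (forall x, A x -> exists N0, forall N, (N0 <= N)%N -> An N x) ->
  (forall N, exists2 B, measurable B & An N `<=` B /\ (mu B <= e%:E)%E) ->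
  exists2 B, measurable B & A `<=` B /\ (mu B <= e%:E)%E.
Proof.
move=> AAn /(_ _)/cid2-/all_sig[B] /all_and2[mB BP].
(* The tail intersections increase and still have measure at most [e]; their union contains [A]. *)
pose C N := \bigcap_(i in [set i | (N <= i)%N]) B i.
have mC N : measurable (C N) by apply: bigcap_measurable => //; exists N => /=.
exists (\bigcup_N C N); first exact: bigcupT_measurable.
split=> [x /AAn[N0 N0P]|].
  by exists N0 => // i /N0P; have [+ _] := BP i; exact.
have cvgC : mu \o C @ \oo --> mu (\bigcup_N C N).
  apply: nondecreasing_cvg_mu => //; first exact: bigcupT_measurable.
  move=> N N' NN'; apply/subsetPset => x Cx i /= N'i; apply: Cx => /=.
  exact: leq_trans N'i.
rewrite -(cvg_lim _ cvgC)//; apply: lime_le; first by apply/cvg_ex; exists (mu (\bigcup_N C N)).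
apply: nearW => N; apply: le_trans (BP N).2; apply: le_measure; rewrite ?inE//.
by apply: bigcap_inf => /=.
Qed.

Lemma measure_bigsetU_le (I : Type) (s : seq I) (F : I -> set T) :
  (forall i, measurable (F i)) ->
  (mu (\big[setU/set0]_(i <- s) F i) <= \sum_(i <- s) mu (F i))%E.
Proof.
move=> mF; elim: s => [|i s IH]; first by rewrite !big_nil measure0.
rewrite !big_cons; apply: le_trans (measureU2 _ _ _) _ => //.
  exact: bigsetU_measurable.
exact: leeD2l.
Qed.

End negligible_liminf.

Section tuple_cells.
Context (R : realType) (k : nat).

Definition tuple_cell (D : nat) (p : 'I_k -> R) (c : {ffun 'I_k -> 'I_D}) :
    set (k.-tuple (measurableTypeR R)) :=
  [set t | forall l, `[p l + (c l)%:R / D%:R, p l + (c l).+1%:R / D%:R]%classic (tnth t l)].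

Lemma measurable_tuple_cell D p c : measurable (@tuple_cell D p c).
Proof.
rewrite (_ : tuple_cell _ _ = \bigcap_(l in [set: 'I_k])
  ((@tnth _ (measurableTypeR R))^~ l @^-1`
    `[p l + (c l)%:R / D%:R, p l + (c l).+1%:R / D%:R]%classic)).
  apply: fin_bigcap_measurable => // l _.
  by rewrite -[X in measurable X]setTI; exact: measurable_tnth.
by apply/seteqP; split=> t /= At l; [move=> _; exact: At | exact: At].
Qed.

Lemma measure_tuple_cell D p c : (0 < D)%N ->
  lebesgue_tuple R k (@tuple_cell D p c) = ((D%:R^-1) ^+ k)%:E.
Proof.
move=> D0; rewrite /tuple_cell.
rewrite (@lebesgue_tuple_box R k (fun l =>
  `[p l + (c l)%:R / D%:R, p l + (c l).+1%:R / D%:R]%classic)) => [|l]; last first.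
  exact: measurable_itv.
have DR : 0 < D%:R^-1 :> R by rewrite invr_gt0 ltr0n.
rewrite (eq_bigr (fun=> (D%:R^-1 : R)%:E)) => [|l _].
  rewrite -[X in _ ^+ X]card_ord -prodr_const prodEFin//.
rewrite lebesgue_measure_itv/= lte_fin ltrD2l ltr_pM2r// ltr_nat ltnSn.
by rewrite -EFinD; congr (_%:E); rewrite -natr1; ring.
Qed.

Lemma tuple_cell_grid D p (t : k.-tuple R) : (0 < D)%N ->
  (forall l, p l <= tnth t l < p l + 1) -> exists c, @tuple_cell D p c t.
Proof.
move=> D0 tp; have DR : 0 < D%:R :> R by rewrite ltr0n.
pose f l := Num.truncn ((tnth t l - p l) * D%:R).
have fD l : (f l < D)%N.
  have /andP[h1 h2] := tp l; rewrite truncn_lt_nat.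
    by rewrite -[ltRHS]mul1r ltr_pM2r//; lra.
  by rewrite mulr_ge0 ?ler0n// subr_ge0.
exists [ffun l => Ordinal (fD l)] => l /=; rewrite ffunE/= in_itv/=.
have /andP[h1 h2] := tp l.
have : 0 <= (tnth t l - p l) * D%:R by rewrite mulr_ge0 ?ler0n// subr_ge0.
move=> /truncn_itv/andP[]; rewrite -/(f l) -ler_pdivrMr// => h3.
rewrite -ltr_pdivlMr// => h4; apply/andP; split; lra.
Qed.

End tuple_cells.

Lemma continuous_affine_comb (R : realType) (T : topologicalType) (k : nat)
    (a : 'I_k -> R) (f0 : T -> R) (f : 'I_k -> T -> R) :
  continuous f0 -> (forall i, continuous (f i)) ->
  continuous (fun z => f0 z + \sum_(i < k) a i * f i z).
Proof.
move=> cf0 cf z; apply: cvgD; first exact: cf0.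
elim: (index_enum _) => [|i s IH].
  by under eq_fun do rewrite big_nil; rewrite big_nil; exact: cvg_cst.
under eq_fun do rewrite big_cons.
by rewrite big_cons; apply: cvgD => //; apply: cvgMl_tmp; exact: cf.
Qed.

(** * Negligibility of the parameters with thin projections *)

Section negligible_thin.
Context (R : realType) (n k : nat).
Local Notation m := (k.+1 * n)%N.

Lemma open_block_proj_ball (t : k.-tuple R) (y : 'rV[R]_n) (r : R) :
  open [set x : 'rV[R]_m | forall c, `|(block_proj t x - y) 0 c| < r].
Proof.
rewrite openE => x xc; apply: (@filter_forall _ _ (fun c =>
  [set z : 'rV[R]_m | `|(block_proj t z - y) 0 c| < r]) (nbhs x)) => c.
pose g (z : 'rV[R]_m) : R := vec_mx z ord0 c +
  \sum_(i < k) tnth t i * vec_mx z (lift ord0 i) c.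
have gE z : `|(block_proj t z - y) 0 c| = `|g z - y 0 c|.
  by rewrite /g -block_projE [X in `|X|]mxE [X in _ + X]mxE.
have cc i : continuous (fun z : 'rV[R]_m => vec_mx z i c).
  move=> z; have -> : (fun z : 'rV[R]_m => vec_mx z i c) = (fun z => z 0 (mxvec_index i c)).
    by apply/funext => z'; rewrite mxE.
  exact: coord_continuous.
have cg : continuous g.
  by apply: continuous_affine_comb => [|i]; exact: cc.
have := xc c; rewrite /= gE => gx.
have nb : nbhs (g x) (ball (y 0 c) r).
  by apply: open_nbhs_nbhs; split; [exact: ball_open|rewrite -ball_normE /= distrC].
have := cg x _ nb; congr (nbhs x _).
by apply/seteqP; split=> z; rewrite /= gE -ball_normE /= distrC.
Qed.

(** With [P = 2 ^ q], this follows from the vanishing of the [q]-dimensional measure of the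
    projection: at every small scale there is a cover by sup-norm balls of dyadic radii, the sum of
    the [q]-th powers being at most 1 up to a constant. *)
Definition thin (P : R) (X : set 'rV[R]_m) : set (k.-tuple R) :=
  [set t | forall j0, exists (y : nat -> 'rV[R]_n) (lv : nat -> nat),
    [/\ forall i, (j0 <= lv i)%N, forall N, \sum_(i < N) P ^- lv i <= 1 &
      forall x, X x -> exists i, forall c,
        `|(block_proj t x - y i) 0 c| < 2 * 2 ^- lv i]].

Lemma bernoulli_ineq (x : R) (N : nat) : 0 <= x -> x <= 1 ->
  1 - N%:R * x <= (1 - x) ^+ N.
Proof.
move=> x0 x1; elim: N => [|N IH]; first by rewrite mul0r subr0.
have x1' : 0 <= 1 - x by rewrite subr_ge0.
rewrite exprS; apply: le_trans (ler_wpM2l x1' IH).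
have : 0 <= N%:R * x * x by rewrite !mulr_ge0.
by rewrite -natr1; lra.
Qed.

(** By Bernoulli's inequality, [th = 1 - x] works, with [x] so small that [N.+1%:R * x] is half of
    [1 - v]. *)
Lemma exists_root_gap (v : R) (N : nat) : 0 <= v -> v < 1 ->
  exists th : R, [/\ 0 < th, th < 1 & v < th ^+ N].
Proof.
move=> v0 v1; pose x := (1 - v) / (2 * N.+1%:R).
have N0 : 0 < 2 * N.+1%:R :> R by rewrite mulr_gt0.
have x0 : 0 < x by rewrite divr_gt0// subr_gt0.
have x1 : x < 1.
  rewrite ltr_pdivrMr// mul1r; have : 1 <= N.+1%:R :> R by rewrite ler1n.
  by lra.
exists (1 - x); split; [lra|lra|].
apply: lt_le_trans (bernoulli_ineq N (ltW x0) (ltW x1)).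
have : N.+1%:R * x = (1 - v) / 2 by rewrite /x; field; rewrite gt_eqF.
by rewrite -natr1; lra.
Qed.

Section thin_box.
Variables (P beta : R) (X : set 'rV[R]_m).
Hypotheses (k0 : (0 < k)%N) (P0 : 0 < P) (beta0 : 0 < beta)
  (gap : P ^+ k.+1 * beta < 1) (aX : analytic X)
  (X0 : (0 < net_content (@cell R m) (fun j => beta ^+ j)%R X)%E).

Let b0 j : 0 <= beta ^+ j. Proof. by rewrite exprn_ge0// ltW. Qed.

Lemma thin_box_negligible (p : 'I_k -> R) :
  (lebesgue_tuple R k).-negligible
    (thin P X `&` [set t | forall l, p l <= tnth t l < p l + 1]).
Proof.
have [th [th0 th1 thgap]] := exists_root_gap (m + k.+1)
  (mulr_ge0 (exprn_ge0 k.+1 (ltW P0)) (ltW beta0)) gap.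
pose box (L : nat) : set 'rV[R]_m := [set x | forall l, `|x 0 l| <= L%:R].
(* Restricting to a large box provides compactness; continuity from below keeps the content
   positive. *)
have [L XL0] : exists L, (0%R%:E < net_content (@cell R m) (fun j => beta ^+ j)%R (X `&` box L))%E.
  apply: (net_content_bigcup (@cell_nested R m) b0) => [L x [Xx xL]|].
    by split=> // l; apply: le_trans (xL l) _; rewrite ler_nat.
  suff <- : X = \bigcup_L (X `&` box L) by [].
  apply/seteqP; split=> [x Xx|x [L _ []]//].
  exists (Num.truncn (\sum_l `|x 0 l|)).+1 => //; split=> // l.
  apply: (@le_trans _ _ (\sum_l `|x 0 l|)); last exact/ltW/truncnS_gt.
  by rewrite (bigD1 l)//= lerDl sumr_ge0.
have [a a0 aXL] : exists2 a : R, 0 < a &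
    (a%:E < net_content (@cell R m) (fun j => beta ^+ j)%R (X `&` box L))%E.
  move: XL0; case: net_content => [r| |]//; last by exists 1 => //; rewrite ltry.
  by rewrite lte_fin => r0; exists (r / 2); rewrite ?lte_fin; lra.
have cbox : compact (box L).
  have := @rV_compact R m (fun=> `[- L%:R, L%:R]%classic) (fun=> @segment_compact _ _ _).
  congr compact; apply/seteqP; split=> x /= xL l; have := xL l; rewrite /= in_itv/= ler_norml//.
have clbox : closed (box L) by apply: compact_closed => //; exact: norm_hausdorff.
have aXb : analytic (X `&` box L) by apply: analyticI => //; exact: closed_analytic.
have [A [AX Adec aA Acov]] := analytic_capacitable
  (fun E ndE => net_content_bigcup (@cell_nested R m) b0 (a := a) ndE)
  aXb cbox (@subIsetr _ _ _) aXL.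
pose B : R := \sum_l `|p l| + 1.
have B0 : 0 <= B by rewrite addr_ge0// sumr_ge0.
have pB l : `|p l| + 1 <= B by rewrite lerD2r (bigD1 l)//= lerDl sumr_ge0.
apply: negligible_small_covers => e0 e0_gt0.
pose e := Num.min e0 1.
have e_gt0 : 0 < e by rewrite lt_min e0_gt0 ltr01.
have e1 : e <= 1 by rewrite ge_min lexx orbT.
have [j0 j0P] := counting (n := n) (L := L%:R) k0 P0 beta0 th0 th1 (ler0n _ _) B0 a0 e_gt0 e1 thgap.
(* Any thin parameter of the box lies in [T N] for all large [N], so it is enough to cover each
   [T N] by a set of measure at most [e0]. *)
pose T N : set (k.-tuple (measurableTypeR R)) := [set t | good_cover P j0 N (A N) t /\
  forall l, p l <= tnth t l < p l + 1].
apply: (@liminf_cover _ _ _ (lebesgue_tuple R k) _ T e0) => [t [tthin tbox]|N].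
  have [y [lv [lvj lvP Xt]]] := tthin j0.
  pose V i := [set x : 'rV[R]_m | forall c, `|(block_proj t x - y i) 0 c| < 2 * 2 ^- lv i].
  have [|x [Xx _]|N0 AN0] := Acov V.
  - by move=> i; exact: open_block_proj_ball.
  - by have [i xi] := Xt x Xx; exists i.
  (* Beyond [N0] the finite subfamily covers [A N], and beyond the maximum its levels are all at
     most [N]. *)
  exists (maxn N0 (\max_(i < N0) lv i)) => N; rewrite geq_max => /andP[N0N lvN].
  split=> //; exists (fun i => y i), (fun i => lv i); split=> // x ANx.
  have AN0x : A N0 x.
    move: ANx; rewrite -(subnK N0N); elim: (N - N0)%N => // q IH; rewrite addSn.
    by move/Adec/IH.
  have [i /= iN0 Vi] := AN0 x AN0x.
  have iN : (i < N.+1)%N by rewrite ltnS (leq_trans (ltnW iN0)).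
  exists (Ordinal iN) => //=.
  by apply: leq_trans lvN; exact: (leq_bigmax_cond (Ordinal iN0)).
have [|D D0 SD] := j0P (A N) N p pB _ (aA N); first by move=> x /AX[_ xL].
(* At most [e * D%:R ^+ k] grid cells meet [T N], each of measure [D%:R^-1 ^+ k]. *)
pose S : {set {ffun 'I_k -> 'I_D}} := 
  finset (fun c => `[< (T N `&` tuple_cell p c) !=set0 >]).
have Scard : #|S|%:R <= e * D%:R ^+ k.
  apply: SD => c; rewrite inE => /asboolP[t [[tg _] tc]].
  exists t; first exact: tg.
  by move=> l; move: tc => /(_ l); rewrite /= in_itv.
exists (\big[setU/set0]_(c in S) tuple_cell p c).
  by apply: bigsetU_measurable => c _; exact: measurable_tuple_cell.
split=> [t Tt|].
  have [c tc] := tuple_cell_grid D0 Tt.2.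
  have cS : c \in S by rewrite inE; apply/asboolP; exists t.
  by rewrite (bigD1 c)//=; left.
rewrite -big_filter; apply: le_trans (measure_bigsetU_le _ _ _) _.
  by move=> c; exact: measurable_tuple_cell.
rewrite (eq_bigr (fun=> (D%:R^-1 ^+ k)%:E)); last first.
  by move=> c _; rewrite /= measure_tuple_cell.
rewrite big_filter sumEFin sumr_const lee_fin -[leLHS]mulr_natl.
apply: (@le_trans _ _ e); last by rewrite ge_min lexx.
rewrite exprVn ler_pdivrMr// exprn_gt0// ltr0n//.
Qed.

Lemma thin_negligible : (lebesgue_tuple R k).-negligible (thin P X).
Proof.
pose p (i : nat) : {ffun 'I_k -> int} := odflt [ffun=> 0] (unpickle i).
have -> : thin P X = \bigcup_i (thin P X `&`
    [set t | forall l, (p i l)%:~R <= tnth t l < (p i l)%:~R + 1]).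
  apply/seteqP; split=> [t tX|t [i _ []]//].
  exists (pickle [ffun l => Num.floor (tnth t l)]) => //; split=> // l.
  rewrite /p pickleK /= ffunE; have := floor_itv (tnth t l).
  by rewrite intrD.
apply: negligible_bigcup => i; exact: thin_box_negligible.
Qed.

End thin_box.
End negligible_thin.

(** * Hausdorff measures *)

Section hausdorff_conversions.
Context (R : realType).

Lemma ediam_pow_ge0 m s (A : set 'rV[R]_m) : (0 <= ediam_pow s A)%E.
Proof. by rewrite /ediam_pow; case: ifP => // _; exact: poweR_ge0. Qed.

Lemma hausdorff_content_ge0 m s d (A : set 'rV[R]_m) : (0 <= hausdorff_content s d A)%E.
Proof.
apply: le_ereal_inf_tmp => _ [U _ <-]; apply: nneseries_ge0 => i _ _.
exact: ediam_pow_ge0.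
Qed.

Lemma hausdorff_measure_eq0 m s (A : set 'rV[R]_m) :
  (forall d : R, 0 < d -> (hausdorff_content s d A <= 0)%E) -> hausdorff_measure s A = 0%E.
Proof.
move=> A0; apply/eqP; rewrite eq_le; apply/andP; split.
  by apply: ge_ereal_sup => _ [d d0 <-]; exact: A0.
apply: ereal_sup_ubound; exists 1 => //=.
by apply/eqP; rewrite eq_le A0//= hausdorff_content_ge0.
Qed.

Lemma edist_le_sup m (x y : 'rV[R]_m) (d : R) : 0 <= d ->
  (forall i, `|x 0 i - y 0 i| <= d) -> Defs.edist x y <= m.+1%:R * d.
Proof.
move=> d0 xy; rewrite /Defs.edist.
have -> : m.+1%:R * d = Num.sqrt ((m.+1%:R * d) ^+ 2).
  by rewrite sqrtr_sqr ger0_norm// mulr_ge0.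
rewrite ler_sqrt ?exprn_ge0 ?mulr_ge0//.
apply: (@le_trans _ _ (\sum_(i < m) d ^+ 2)).
  by apply: ler_sum => i _; rewrite -real_normK ?num_real// lerXn2r ?nnegrE.
rewrite sumr_const card_ord -[leLHS]mulr_natl exprMn ler_wpM2r ?exprn_ge0//.
by rewrite -natrX ler_nat expnS expn1 (leq_trans (leqnSn m))// leq_pmulr.
Qed.

Lemma coord_le_edist m (x y : 'rV[R]_m) i : `|x 0 i - y 0 i| <= Defs.edist x y.
Proof.
rewrite /Defs.edist -sqrtr_sqr ler_wsqrtr// (bigD1 i)//= lerDl sumr_ge0// => j _.
exact: sqr_ge0.
Qed.

Lemma cell_dist m j (x y : 'rV[R]_m) i : cell j x = cell j y ->
  `|x 0 i - y 0 i| <= 2 ^- j.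
Proof.
move=> /rowP/(_ i); rewrite !mxE => xy.
have := floor_itv (2 ^+ j * x 0 i); have := floor_itv (2 ^+ j * y 0 i).
rewrite xy intrD => /andP[h1 h2] /andP[h3 h4].
rewrite -[leRHS]mul1r ler_pdivlMr ?exprn_gt0// -[X in _ * X]ger0_norm ?exprn_ge0//.
by rewrite -normrM mulrC mulrBr ler_norml; apply/andP; split; lra.
Qed.

(** A cover by cells of small total cost has only small cells, so it also satisfies the diameter
    constraint of the Hausdorff content. *)
Lemma hausdorff_measure_net_content m (alpha : R) (X : set 'rV[R]_m) : 0 < alpha ->
  net_content (@cell R m) (fun j => (2 `^ (- alpha)) ^+ j)%R X = 0%E ->
  hausdorff_measure alpha X = 0%E.
Proof.
move=> al0 X0; apply: hausdorff_measure_eq0 => d d0.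
pose M : R := m.+1%:R; have M0 : 0 < M by rewrite ltr0n.
have MA0 : 0 < M `^ alpha by rewrite powR_gt0.
apply/lee_addgt0Pr => e e0; rewrite add0e.
(* The first bound absorbs the constant relating diameters to cell sizes; the second forces every
   cell used to have diameter at most [d]. *)
pose e' := Num.min (e / M `^ alpha) ((d / M) `^ alpha).
have e'0 : 0 < e' by rewrite lt_min divr_gt0// powR_gt0// divr_gt0.
pose b (j : nat) : R := (2 `^ (- alpha)) ^+ j.
have b0 j : 0 <= b j by rewrite exprn_ge0// powR_ge0.
have bE j : b j = (2 ^- j) `^ alpha.
  by rewrite /b -powR_mulrn ?powR_ge0// -powRrM mulNr mulrC -mulNr powRrM powR_invn.
have [_ [U UX <-] Ue] : exists2 y, [set net_cost b U | U in [set U | net_cover (@cell R m) U X]] y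
    & (y < e'%:E)%E.
  by apply: ereal_inf_lt; rewrite -/(net_content _ _ _) X0 lte_fin.
have Ub q : U q -> b q.1 < e'.
  move=> Uq; rewrite -lte_fin; apply: le_lt_trans Ue.
  rewrite -(esum_set1 (a := fun q : nat * 'rV[int]_m => (b q.1)%:E) (t := q)) ?lee_fin//.
  by apply: esum_subset => // _ ->.
pose V (l : nat) : set 'rV[R]_m := if @pickle_inv (nat * 'rV[int]_m)%type l is Some q then
  [set x | U q /\ cell q.1 x = q.2] else set0.
pose f (l : nat) : R := if @pickle_inv (nat * 'rV[int]_m)%type l is Some q then
  if q \in U then b q.1 else 0 else 0.
have f0 l : (0 <= (f l)%:E)%E.
  by rewrite lee_fin /f; case: pickle_inv => // q; case: ifP.
have Vdist l (q : nat * 'rV[int]_m) x y : @pickle_inv (nat * 'rV[int]_m)%type l = Some q ->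
    V l x -> V l y -> Defs.edist x y <= M * 2 ^- q.1.
  move=> lq; rewrite /V lq => -[_ xq] [_ yq]; apply: edist_le_sup => // i.
  by apply: cell_dist; rewrite xq yq.
apply: ge_ereal_inf; exists (\sum_(i <oo) ediam_pow alpha (V i))%E.
  exists V => //; split=> [x /UX[j Uj]|l].
    by exists (pickle (j, cell j x)) => //; rewrite /V pickleK_inv.
  apply: ge_ereal_sup => _ [x Vx [y Vy <-]]; rewrite lee_fin.
  have [q lq] : exists q : nat * 'rV[int]_m, @pickle_inv (nat * 'rV[int]_m)%type l = Some q.
    by move: Vx; rewrite /V; case: pickle_inv => // q; exists q.
  apply: (le_trans (Vdist l q x y lq Vx Vy)).
  have Uq : U q by move: Vx; rewrite /V lq => -[].
  have := Ub q Uq; rewrite bE lt_min => /andP[_].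
  move=> h; rewrite mulrC -ler_pdivlMr// leNgt; apply/negP => /ltW lt.
  have dM0 : 0 <= d / M by rewrite divr_ge0 ?ltW.
  have p0 : 0 <= 2 ^- q.1 :> R by rewrite invr_ge0 exprn_ge0.
  by have := ge0_ler_powR (ltW al0) dM0 p0 lt; rewrite leNgt h.
apply: (@le_trans _ _ (\sum_(l <oo) ((M `^ alpha)%:E * (f l)%:E))%E).
  apply: lee_nneseries => [l _ _|l _]; first exact: ediam_pow_ge0.
  rewrite /ediam_pow; case: ifPn => [_|/set0P[x Vx]].
    by rewrite mule_ge0// lee_fin ltW.
  have [q lq] : exists q : nat * 'rV[int]_m, @pickle_inv (nat * 'rV[int]_m)%type l = Some q.
    by move: Vx; rewrite /V; case: pickle_inv => // q; exists q.
  have Uq : U q by move: Vx; rewrite /V lq => -[].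
  rewrite /f lq mem_set// bE -EFinM -powRM ?(ltW M0)// -poweR_EFin.
  have d1 : (ediam (V l) <= (M * 2 ^- q.1)%:E)%E.
    by apply: ge_ereal_sup => _ [y Vy [z Vz <-]]; rewrite lee_fin; exact: (Vdist l q).
  have d2 : (0 <= ediam (V l))%E.
    apply: ereal_sup_ubound; exists x => //; exists x => //; congr (_%:E).
    by rewrite /Defs.edist big1 ?sqrtr0// => i _; rewrite subrr expr0n.
  apply: gt0_ler_poweR => //; first exact: ltW.
  - by rewrite in_itv/= d2 leey.
  - by rewrite in_itv/= (le_trans d2 d1) leey.
rewrite nneseriesZl//.
apply: (@le_trans _ _ ((M `^ alpha)%:E * e'%:E)%E); last first.
  by rewrite -EFinM lee_fin mulrC -ler_pdivlMr// ge_min lexx.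
apply: lee_wpmul2l; first by rewrite lee_fin ltW.
apply: le_trans (ltW Ue); rewrite nneseries_esumT//.
have -> : net_cost b U = (\esum_(l in pickle @` U) (f l)%:E)%E.
  rewrite esum_image; last by move=> q q' _ _; exact: (pcan_inj pickleK).
  by apply: eq_esum => q Uq; rewrite /f pickleK_inv mem_set.
rewrite [leRHS]esum_mkcond; apply: le_esum => l _.
case: ifPn => // /negP lU; rewrite lee_fin /f.
case lq : (@pickle_inv (nat * 'rV[int]_m)%type l) => [q|//]; case: ifPn => //.
move=> /set_mem Uq; exfalso; apply: lU.
by rewrite inE; exists q => //; have := @pickle_invK (nat * 'rV[int]_m)%type l; rewrite lq.
Qed.

End hausdorff_conversions.

(** * From null projections to thin parameters *)

Section thin_images.
Context (R : realType).

(* Each set of a cover is enclosed in a ball of dyadic radius, at the price of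
   [P], plus a summable error that takes care of the singletons. *)
Lemma dyadic_ball_cover n (U : set 'rV[R]_n) (s q e : R) (j0 : nat) :
  0 <= s -> s <= q -> 0 < q -> 0 < e -> (ediam U <= (2 ^- j0)%:E)%E ->
  exists (y : 'rV[R]_n) (j : nat), [/\ (j0 <= j)%N,
    (((2 `^ q) ^- j)%:E <= e%:E + (2 `^ q)%:E * ediam_pow s U)%E &
    forall z, U z -> forall c, `|(z - y) 0 c| < 2 * 2 ^- j].
Proof.
move=> s0 sq q0 e0 Uj0; pose P : R := 2 `^ q.
have P1 : 1 < P.
  have := @gt0_ltr_powR R q q0 1 2; rewrite powR1; apply; rewrite ?nnegrE//.
  by rewrite ltr1n.
have P0 : 0 < P by apply: lt_trans P1.
have edp0 : (0 <= P%:E * ediam_pow s U)%E.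
  by rewrite mule_ge0 ?ediam_pow_ge0// lee_fin ltW.
have [j1 j1P] : exists j1, forall j, (j1 <= j)%N -> P^-1 ^+ j < e.
  by apply: exprn_eventually_small; rewrite ?invr_ge0 ?(ltW P0)// invf_lt1.
(* A level so fine that the error [e] alone pays for the ball; it serves for the empty set and for
   sets of diameter zero. *)
have small : ((P ^- maxn j0 j1)%:E <= e%:E + P%:E * ediam_pow s U)%E.
  apply: le_trans (leeDl _ edp0); rewrite lee_fin -exprVn.
  by apply/ltW/j1P; exact: leq_maxr.
have [U0|/set0P[y Uy]] := eqVneq U set0.
  by exists 0, (maxn j0 j1); split=> //; [exact: leq_maxl|rewrite U0].
have dist z : U z -> ((Defs.edist z y)%:E <= ediam U)%E.
  by move=> Uz; apply: ereal_sup_ubound; exists z => //; exists y.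
have coord z c : U z -> (`|(z - y) 0 c|%:E <= ediam U)%E.
  move=> Uz; apply: le_trans (dist z Uz); rewrite lee_fin.
  by rewrite !mxE; exact: coord_le_edist.
have dU0 : (0 <= ediam U)%E.
  apply: le_trans (dist y Uy); rewrite lee_fin; exact: sqrtr_ge0.
have [r rE] : exists r, ediam U = r%:E.
  by exists (fine (ediam U)); rewrite fineK// ge0_fin_numE// (le_lt_trans Uj0) ?ltry.
rewrite rE in coord dU0 Uj0; rewrite lee_fin in Uj0; rewrite lee_fin in dU0.
have [r0|r0] := eqVneq r 0.
  exists y, (maxn j0 j1); split=> //; first exact: leq_maxl.
  move=> z Uz c; have := coord z c Uz; rewrite lee_fin r0 => /le_lt_trans; apply.
  by rewrite mulr_gt0// invr_gt0 exprn_gt0.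
have {}r0 : 0 < r by rewrite lt_def r0.
have half0 : (0 : R) <= 2^-1 by rewrite invr_ge0.
have half1 : (2^-1 : R) < 1 by rewrite invf_lt1// ltr1n.
(* The least such [j] gives [r <= 2 ^- j], and [P ^- j = P * (2 ^- j.+1) ^ q] is at most
   [P * r ^ q], hence at most [P * r ^ s] because [r] is at most 1. *)
have ex : exists j, (j0 <= j)%N && (2 ^- j.+1 < r).
  have [j2 j2P] := exprn_eventually_small half0 half1 r0.
  exists (maxn j0 j2); rewrite leq_maxl/= -exprVn; apply: j2P.
  by rewrite ltnW// ltnS leq_maxr.
have [j /andP[j0j rj] jmin] := ex_minnP ex.
have jr : r <= 2 ^- j.
  move: j0j; rewrite leq_eqVlt => /predU1P[<-//|j0j].
  case: j j0j jmin {rj} => // j j0j jmin; rewrite leNgt; apply/negP => rj.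
  by have := jmin j; rewrite rj -ltnS j0j ltnn => /(_ isT).
exists y, j; split=> // [|z Uz c]; last first.
  have := coord z c Uz; rewrite lee_fin => /le_lt_trans; apply.
  apply: (le_lt_trans jr).
  by have : 0 < 2 ^- j :> R; [rewrite invr_gt0 exprn_gt0|lra].
have -> : ediam_pow s U = (r `^ s)%:E.
  by rewrite /ediam_pow rE poweR_EFin ifN//; apply/set0P; exists y.
rewrite -EFinM -EFinD lee_fin; apply: (@le_trans _ _ (P * r `^ s)); last by rewrite lerDr ltW.
rewrite -/P; have -> : P ^- j = P * P ^- j.+1.
  by rewrite exprS invfM mulrA divff ?mul1r// gt_eqF.
rewrite ler_pM2l//.
have -> : P ^- j.+1 = (2 ^- j.+1) `^ q.
  by rewrite -[in RHS]powR_invn// -powRrM mulrC powRrM powR_invn// powR_ge0.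
have r1 : r <= 1 by apply: le_trans jr _; rewrite -exprVn exprn_ile1// ltW.
apply: (@le_trans _ _ (r `^ q)); last by apply: ger_powR => //; rewrite r0.
by apply: ge0_ler_powR; rewrite ?nnegrE ?(ltW q0) ?(ltW r0) ?(ltW rj)// invr_ge0 exprn_ge0.
Qed.

(** The total weight 1 is split in two halves: one for the errors of [dyadic_ball_cover], which sum
    geometrically, and one for [P] times a content below [2^-1 / P]. *)
Lemma hausdorff0_thin n k (X : set 'rV[R]_(k.+1 * n)) (t : k.-tuple R) (s q : R) :
  0 <= s -> s <= q -> 0 < q -> hausdorff_measure s (block_proj t @` X) = 0%E ->
  thin (2 `^ q) X t.
Proof.
move=> s0 sq q0 H0 j0; pose P : R := 2 `^ q.
have P0 : 0 < P by rewrite powR_gt0.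
have d0 : 0 < 2 ^- j0 :> R by rewrite invr_gt0 exprn_gt0.
have c0 : (hausdorff_content s (2 ^- j0) (block_proj t @` X) < (2^-1 / P)%:E)%E.
  apply: (@le_lt_trans _ _ 0%E); last by rewrite lte_fin divr_gt0.
  by rewrite -H0; apply: ereal_sup_ubound; exists (2 ^- j0).
have [_ [U [XU Ud] <-] Uc] := ereal_inf_lt c0.
have /choice[yj yjP] i : exists p : 'rV[R]_n * nat, [/\ (j0 <= p.2)%N,
    ((P ^- p.2)%:E <= (2^-1 / (2 ^ i.+1)%:R)%:E + P%:E * ediam_pow s (U i))%E &
    forall z, U i z -> forall c, `|(z - p.1) 0 c| < 2 * 2 ^- p.2].
  have e0 : 0 < 2^-1 / (2 ^ i.+1)%:R :> R by rewrite divr_gt0// ltr0n expn_gt0.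
  have [y [j yjP]] := dyadic_ball_cover s0 sq q0 e0 (Ud i).
  by exists (y, j).
exists (fun i => (yj i).1), (fun i => (yj i).2); split=> [i|N|x Xx].
- by have [] := yjP i.
- rewrite -lee_fin -sumEFin.
  apply: (@le_trans _ _ (\sum_(i < N) ((2^-1 / (2 ^ i.+1)%:R)%:E + P%:E * ediam_pow s (U i)))%E).
    by apply: lee_sum => i _; have [_ + _] := yjP i.
  rewrite big_split/= sumEFin -ge0_sume_distrr; last by move=> i _; exact: ediam_pow_ge0.
  have geo : \sum_(i < N) 2^-1 / (2 ^ i.+1)%:R = 2^-1 - 2^-1 / (2 ^ N)%:R :> R.
    elim: N => [|N IH]; first by rewrite big_ord0 expn0 divr1 subrr.
    rewrite big_ord_recr/= IH expnS natrM invfM.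
    by set w := ((2 ^ N)%:R)^-1; lra.
  have -> : (1%:E = (2^-1)%:E + P%:E * (2^-1 / P)%:E :> \bar R)%E.
    by rewrite -EFinM -EFinD; congr (_%:E); field; rewrite gt_eqF.
  apply: leeD; first by rewrite lee_fin geo gerBl divr_ge0// ler0n.
  apply: lee_wpmul2l; first by rewrite lee_fin ltW.
  apply: le_trans (ltW Uc); rewrite -(big_mkord xpredT (fun i => ediam_pow s (U i))).
  by apply: nneseries_lim_ge => i _ _; exact: ediam_pow_ge0.
- have [|i _ Ui] := XU (block_proj t x); first by exists x.
  by exists i; have [_ _] := yjP i; exact.
Qed.

Lemma lt_ereal_rat (x : R) (y : \bar R) : (x%:E < y)%E ->
  exists2 q : rat, x < ratr q & ((ratr q)%:E < y)%E.
Proof.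
case: y => [y| |]//.
  rewrite lte_fin => /rat_in_itvoo[q]; rewrite in_itv/= => /andP[xq qy].
  by exists q; rewrite ?lte_fin.
have [q] := @rat_in_itvoo R x (x + 1) (ltr_pwDr ltr01 (lexx x)).
by rewrite in_itv/= => /andP[xq _] _; exists q; rewrite ?ltry.
Qed.

End thin_images.

(** Take [alpha] strictly between [q * k.+1%:R] and the dimension of [X]. The gap condition becomes
    [2 ^ (q * (k + 1) - alpha) < 1], and zero net content would make the [alpha]-dimensional measure
    vanish, against the choice of [alpha]. *)
Lemma thin_hausdorff_negligible (R : realType) (n k : nat) (X : set 'rV[R]_(k.+1 * n)) (q : R) :
  (0 < k)%N -> analytic X -> 0 < q ->
  ((q * k.+1%:R)%:E < hausdorff_dim X)%E ->
  (lebesgue_tuple R k).-negligible (thin (2 `^ q) X).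
Proof.
move=> k0 aX q0 /lt_ereal_rat[al qal alX]; set alpha : R := ratr al in qal alX.
have al0 : 0 < alpha by apply: lt_trans qal; rewrite mulr_gt0.
have beta0 : 0 < 2 `^ (- alpha) :> R by rewrite powR_gt0.
apply: (@thin_negligible R n k (2 `^ q) (2 `^ (- alpha)) X k0 _ beta0 _ aX).
- by rewrite powR_gt0.
- rewrite -powR_mulrn ?powR_ge0// -powRrM powRN ltr_pdivrMr ?powR_gt0// mul1r.
  have := @ler_powR R 2; rewrite ler1n => /(_ isT _ _ (ltW qal)).
  rewrite le_eqVlt => /predU1P[|//]; rewrite /powR !(negPf (lt0r_neq0 _))// => /expR_inj.
  have l2 : 0 < ln (2 : R) by rewrite ln_gt0// ltr1n.
  by move/(mulIf (lt0r_neq0 l2)) => e; rewrite e ltxx in qal.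
- rewrite lt_def net_content_ge0 ?andbT; last by move=> j; rewrite exprn_ge0// ltW.
  apply/eqP => /(hausdorff_measure_net_content al0) H0.
  move: alX; rewrite ltNge => /negP; apply; apply: ereal_inf_lbound.
  by exists alpha => //; split=> //; exact: ltW.
Qed.

Unset Implicit Arguments.

Theorem corollary3p16 (R : realType) (n k : nat) (hn : (1 <= n)%N) (hk : (1 <= k)%N)
  (X : set 'rV[R]_(k.+1 * n)) (X0 : X !=set0) (mX : <<s open >> X) :
  {ae lebesgue_tuple R k, forall t : k.-tuple R,
    (hausdorff_dim X / (k.+1%:R)%:E <= hausdorff_dim (block_proj t @` X))%E}.
Proof.
(* Rational exponents reduce the exceptional set to a countable union of negligible sets. *)
pose N (q : rat) : set (k.-tuple R) := [set t | thin (2 `^ ratr q) X t /\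
  0 < ratr q :> R /\ ((ratr q * k.+1%:R)%:E < hausdorff_dim X)%E].
have N0 q : (lebesgue_tuple R k).-negligible (N q).
  have [[q0 qX]|nq] := pselect (0 < ratr q :> R /\ ((ratr q * k.+1%:R)%:E < hausdorff_dim X)%E).
    apply: (negligibleS _ (thin_hausdorff_negligible hk (borel_analytic mX) q0 qX)).
    by move=> t [].
  suff -> : N q = set0 by exact: negligible_set0.
  by apply/seteqP; split=> // t [_].
pose F (i : nat) := if unpickle i is Some q then N q else set0.
have : (lebesgue_tuple R k).-negligible (\bigcup_i F i).
  apply: negligible_bigcup => i; rewrite /F; case: unpickle => [q|]; first exact: N0.
  exact: negligible_set0.
apply: negligibleS => t /= /negP; rewrite -ltNge => tX.
have k0 : 0 < k.+1%:R :> R by rewrite ltr0n.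
(* Where the inequality fails, the projection has zero [s]-dimensional measure for some [s] below
   [hausdorff_dim X / k.+1]; a rational [q] in between is positive because [s] is nonnegative. *)
have [_ [s [s0 Hs] <-] sX] := ereal_inf_lt tX.
have [q sq qX] := lt_ereal_rat sX.
exists (pickle q) => //; rewrite /F pickleK; split; last first.
  split; first exact: le_lt_trans sq.
  by rewrite EFinM -lte_pdivlMr//; move: qX; rewrite inver gt_eqF.
apply: (hausdorff0_thin s0 (ltW sq) _ Hs).
exact: le_lt_trans sq.
Qed.
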